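(* Suppose that (a) $f:\mathbb{R}^n\to\mathbb{R}$ is twice continuously differentiable and $\sigma_f$-weakly convex (i.e. $f(x)+(\sigma_f/2)\|x\|^2$ is convex), $\nabla f$ is Lipschitz continuous with modulus $\ell_f$, and $\nabla^2 f$ is Lipschitz continuous with modulus $L_f$; (b) $A\in\mathbb{R}^{m\times n}$ has full row rank, with $\gamma>0$ defined by $\gamma^2:=\lambda_{\min}(AA^\top)$; (c) $f$ is coercive, i.e. $f(x)\to\infty$ as $\|x\|\to\infty$; and (d) the parameters satisfy $\mu>\sigma_f$ and $$c_3:=\frac{\mu+\ell_f+c_1}{\gamma},\quad c_4:=\frac{\mu+c_1}{\gamma},\quad \rho>\max\left\{\frac{8(c_3^2+c_4^2)}{\mu},\frac{4\ell_f}{\gamma^2}\right\},\quad \beta:=\frac{4c_4^2}{\rho}.$$ Let $\{(x^k,u^k,y^k)\}$ be the sequence generated by iNALM for the problem (P): $\min_{x,u} f(x)+\lambda h(u)$ subject to $Ax+b=u$, and let $(x^*,u^*,y^* )$ be one of its accumulation points at which the second-order sufficient condition $d^\top\nabla^2f(x^* )d>0$ for all $d\in\mathcal C^*\setminus\{0\}$ holds. Let $\mathcal V_k:=\mathcal V_{\rho,\beta}(x^k,u^k,y^k,x^{k-1})$ and $\mathcal V_*:=\mathcal V_{\rho,\beta}(x^*,u^*,y^*,x^* )=f(x^* )+\lambda\|u^*_+\|_0$. Then there exist a sufficiently large index $k_\nu$ and two positive constants $c_\nu>0$ and $q<1$ such that $$\mathcal V_k-\mathcal V_*\le c_\nu q^k\qquad\text{for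 all } k\ge k_\nu.$$
   Context: $[m]=\{1,\dots,m\}$; for $T\subseteq[m]$, $\overline T:=[m]\setminus T$, $v_T$ is the subvector of $v$ indexed by $T$ and $A_T$ the row-submatrix of $A$. $h(u):=\|u_+\|_0$ is the number of strictly positive entries of $u$. Data: $\lambda,\mu>0$, $b\in\mathbb{R}^m$. Cone: with $\mathcal I_0^*:=\{i\in[m]:u_i^*=0,\,y_i^*=0\}$ and $\mathcal I_+^*:=\{i\in[m]:u_i^*=0,\,y_i^*>0\}$, $\mathcal C^*:=\{d\in\mathbb{R}^n:A_{\mathcal I_+^*}d=0,\ A_{\mathcal I_0^*}d\le0\}$. Define $$\mathcal L_\rho(x,u,y):=f(x)+\langle y,Ax+b-u\rangle+\tfrac\rho2\|Ax+b-u\|^2+\lambda h(u),\qquad \mathcal V_{\rho,\theta}(x,u,y,v):=\mathcal L_\rho(x,u,y)+\tfrac\theta2\|x-v\|^2,$$ $$g_k(x,u):=f(x)+\langle y^k,Ax+b-u\rangle+\tfrac\rho2\|Ax+b-u\|^2+\tfrac\mu2\|x-x^k\|^2 .$$ $\overline\ell_g>0$ is a Lipschitz modulus of $\nabla g_k$ valid for all $k$; $\sigma_g:=\mu-\sigma_f$. GSNewton applied to a function $g$ (with $G:=g+\lambda h$), with $\alpha\in(0,1/\overline\ell_g)$, $t\in(0,2/\overline\ell_g)$ and starting point $\zeta^0$: for $j=0,1,\dots$, with $\zeta^j=(x^j,u^j)$, $y^j:=-\nabla_ug(\zeta^j)$: (1) $\Gamma_j:=\{i\in[m]:[u^j+\alpha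 y^j]_i\in[0,\sqrt{2\alpha\lambda})\}$; (2) $u^{j+1/2}_i:=0$ for $i\in\Gamma_j$, $u^{j+1/2}_i:=[u^j+\alpha y^j]_i$ for $i\notin\Gamma_j$, $x^{j+1/2}:=x^j-t\nabla_xg(x^j,u^{j+1/2})$, $\zeta^{j+1/2}:=(x^{j+1/2},u^{j+1/2})$; (3) $\widetilde\zeta^{j+1}=(x,u)$ solves $u_{\Gamma_j}=0$ and $H^{j+1/2}[x-x^{j+1/2};(u-u^{j+1/2})_{\overline\Gamma_j}]=-[\nabla_xg(\zeta^{j+1/2});(\nabla_ug(\zeta^{j+1/2}))_{\overline\Gamma_j}]$, where $H^{j+1/2}$ is the Hessian of $g$ at $\zeta^{j+1/2}$ in the variables $(x,u_{\overline\Gamma_j})$; (4) $\zeta^{j+1}:=\widetilde\zeta^{j+1}$ if $G(\zeta^{j+1/2})-G(\widetilde\zeta^{j+1})\ge(\sigma_g/4)\|\widetilde\zeta^{j+1}-\zeta^{j+1/2}\|^2$, and $\zeta^{j+1}:=\zeta^{j+1/2}$ otherwise. Residuals: with $\Gamma:=\{i\in[m]:[u-\alpha\nabla_ug_k(x,u)]_i\in[0,\sqrt{2\alpha\lambda})\}$, $\mathcal R_1(x,u):=\|\nabla_xg_k(x,u)\|$, $\mathcal R_2(x,u):=\|[u_\Gamma;\ \alpha(\nabla_ug_k(x,u))_{\overline\Gamma}]\|$, $\mathcal R_3(x,u):=\frac{\alpha^2}2\|\nabla_ug_k(x,u)\|^2+\alpha\lambda\|u_+\|_0-\Phi_{\alpha\lambda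 h(\cdot)}(u-\alpha\nabla_ug_k(x,u))$, where $\Phi_{\alpha\lambda h(\cdot)}(v):=\min_{z}\{\alpha\lambda h(z)+\frac12\|z-v\|^2\}$. Algorithm iNALM: given $\epsilon_k>0$ with $\epsilon_k\to0$, $c_1,c_2>0$ and $(x^0,u^0,y^0)$. At iteration $k=0,1,\dots$: apply GSNewton to $g_k$ from $(x^k,u^k)$, generating $(x^{k,j},u^{k,j})$; stop as soon as an index $j_k$ satisfies $$\mathcal R_1(x^{k,j_k},u^{k,j_k})\le c_1\|x^{k,j_k}-x^k\|,\quad \mathcal R_2(x^{k,j_k},u^{k,j_k})\le c_2\|x^{k,j_k}-x^k\|^2,\quad \mathcal R_3(x^{k,j_k},u^{k,j_k})\le\epsilon_k,$$ and set $(x^{k+1},u^{k+1}):=(x^{k,j_k},u^{k,j_k})$; then $y^{k+1}:=y^k+\rho(Ax^{k+1}+b-u^{k+1})$. If the $x$-part of the limit of the GSNewton sequence equals $x^k$, then $(x^{k+1},u^{k+1})$ is instead taken to be a P-stationary point of $\min g_k+\lambda h$ (that is, $\nabla_xg_k=0$ and $u\in\arg\min_z\{\alpha\lambda h(z)+\frac12\|z-(u-\alpha\nabla_ug_k(x,u))\|^2\}$ at that point) satisfying these three inequalities (with $(x^{k+1},u^{k+1})$ in place of $(x^{k,j_k},u^{k,j_k})$). In all cases $\mathcal V_{\rho,\mu}(x^{k+1},u^{k+1},y^k,x^k)\le\mathcal V_{\rho,\mu}(x^k,u^k,y^k,x^k)$. *)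

(* Defs.v *)
From HB Require Import structures.
From mathcomp Require Import all_boot all_order all_algebra.
From mathcomp Require Import all_classical all_reals all_analysis.

Set Implicit Arguments.
Unset Strict Implicit.
Unset Printing Implicit Defensive.

Import Order.TTheory GRing.Theory Num.Theory.
Import numFieldNormedType.Exports.

Local Open Scope classical_set_scope.
Local Open Scope ring_scope.

Section Euclidean.
Variable R : realType.

Definition dotv n (u v : 'cV[R]_n) : R := \sum_(i < n) u i 0 * v i 0.

(* The library norm on matrices is the sup norm, which induces the same
   topology; every quantitative bound below uses the Euclidean norm. *)
Definition enorm n (u : 'cV[R]_n) : R := Num.sqrt (dotv u u).

Definition opnorm n p (M : 'M[R]_(n, p)) : R :=
  sup [set enorm (M *m v) | v in [set v : 'cV[R]_p | enorm v <= 1]].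

Definition grad n (f : 'cV[R]_n -> R) (x : 'cV[R]_n) : 'cV[R]_n :=
  \col_i 'D_(delta_mx i 0) f x.

Definition hess n (f : 'cV[R]_n -> R) (x : 'cV[R]_n) : 'M[R]_n :=
  \matrix_(i, j) 'D_(delta_mx j 0) (fun z => 'D_(delta_mx i 0) f z) x.

Definition C2 n (f : 'cV[R]_n -> R) : Prop :=
  [/\ forall x, differentiable f x,
      forall x, differentiable (grad f) x &
      continuous (hess f)].

Definition weakly_convex n (sigma : R) (f : 'cV[R]_n -> R) : Prop :=
  convex_function [set: convex_lmodType 'cV[R]_n]
    (fun x : 'cV[R]_n => f x + sigma / 2 * enorm x ^+ 2).

Definition lipschitz_vec n p (l : R) (F : 'cV[R]_n -> 'cV[R]_p) : Prop :=
  forall x z, enorm (F x - F z) <= l * enorm (x - z).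

Definition lipschitz_op n p q (l : R) (F : 'cV[R]_n -> 'M[R]_(p, q)) : Prop :=
  forall x z, opnorm (F x - F z) <= l * enorm (x - z).

Definition coercive n (f : 'cV[R]_n -> R) : Prop :=
  forall M : R, exists r : R, forall x, r <= enorm x -> M <= f x.

Definition is_lambda_min n (M : 'M[R]_n) (l : R) : Prop :=
  eigenvalue M l /\ forall a, eigenvalue M a -> l <= a.

(* ||u_+||_0 *)
Definition h m (u : 'cV[R]_m) : R := #|[pred i | 0 < u i 0]|%:R.

End Euclidean.

(* A pair (x, u) is the block column z = col_mx x u; the partial gradients of
   g at z are the blocks usubmx (grad g z) and dsubmx (grad g z). *)
Section GSNewton.
Variables (R : realType) (n m : nat).
Variables (g : 'cV[R]_(n + m) -> R) (lam alpha : R).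
Implicit Types (z : 'cV[R]_(n + m)) (u v : 'cV[R]_m).

Definition gradx z : 'cV[R]_n := usubmx (grad g z).
Definition gradu z : 'cV[R]_m := dsubmx (grad g z).

Definition workset z : {set 'I_m} :=
  [set i | 0 <= (dsubmx z - alpha *: gradu z) i 0 < Num.sqrt (2 * alpha * lam)]%SET.

Definition half_u z : 'cV[R]_m :=
  \col_i (if i \in workset z then 0 else (dsubmx z - alpha *: gradu z) i 0).

Definition half_step (t : R) z : 'cV[R]_(n + m) :=
  col_mx (usubmx z - t *: gradx (col_mx (usubmx z) (half_u z))) (half_u z).

(* Coordinates of (x, u_{~ Gamma}) inside those of (x, u). *)
Definition free_coords (Gamma : {set 'I_m}) : {set 'I_(n + m)} :=
  (~: [set rshift n i | i in Gamma])%SET.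

Definition newton_point (Gamma : {set 'I_m}) (zh zt : 'cV[R]_(n + m)) : Prop :=
  let e := @enum_val 'I_(n + m) (mem (free_coords Gamma)) in
  (forall i, i \in Gamma -> dsubmx zt i 0 = 0) /\
  mxsub e e (hess g zh) *m rowsub e (zt - zh) = - rowsub e (grad g zh).

Definition Gobj z : R := g z + lam * h (dsubmx z).

Definition gsnewton_step (t sigma : R) (z z' : 'cV[R]_(n + m)) : Prop :=
  let zh := half_step t z in
  exists2 zt, newton_point (workset z) zh zt &
    z' = if Gobj zh - Gobj zt >= sigma / 4 * enorm (zt - zh) ^+ 2
         then zt else zh.

Definition gsnewton_seq (t sigma : R) (z0 : 'cV[R]_(n + m))
    (zeta : nat -> 'cV[R]_(n + m)) : Prop :=
  zeta 0%N = z0 /\ forall j, gsnewton_step t sigma (zeta j) (zeta j.+1).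

Definition prox_obj v u : R := alpha * lam * h u + 2^-1 * enorm (u - v) ^+ 2.

(* The infimum is attained. *)
Definition Phi v : R := inf [set prox_obj v u | u in [set: 'cV[R]_m]].

Definition R1 z : R := enorm (gradx z).

(* The entries of [u_Gamma; alpha (grad_u g)_{~ Gamma}] are kept at their
   original positions, which leaves the norm unchanged. *)
Definition R2 z : R :=
  enorm (\col_i (if i \in workset z then dsubmx z i 0
                 else alpha * gradu z i 0)).

Definition R3 z : R :=
  alpha ^+ 2 / 2 * enorm (gradu z) ^+ 2 + alpha * lam * h (dsubmx z)
  - Phi (dsubmx z - alpha *: gradu z).

Definition inexact (c1 c2 eps : R) (xk : 'cV[R]_n) z : Prop :=
  [/\ R1 z <= c1 * enorm (usubmx z - xk),
      R2 z <= c2 * enorm (usubmx z - xk) ^+ 2 &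
      R3 z <= eps].

Definition P_stationary z : Prop :=
  gradx z = 0 /\
  forall w, prox_obj (dsubmx z - alpha *: gradu z) (dsubmx z)
            <= prox_obj (dsubmx z - alpha *: gradu z) w.

End GSNewton.

Section iNALM.
Variables (R : realType) (n m : nat).
Variables (f : 'cV[R]_n -> R) (A : 'M[R]_(m, n)) (b : 'cV[R]_m).
Variables (lam mu rho sigma_f alpha t c1 c2 : R) (eps : nat -> R).
Implicit Types (x v : 'cV[R]_n) (u y : 'cV[R]_m).

Definition calL x u y : R :=
  f x + dotv y (A *m x + b - u) + rho / 2 * enorm (A *m x + b - u) ^+ 2
  + lam * h u.

Definition calV (theta : R) x u y v : R :=
  calL x u y + theta / 2 * enorm (x - v) ^+ 2.

Definition gk (yk : 'cV[R]_m) (xk : 'cV[R]_n) (z : 'cV[R]_(n + m)) : R :=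
  let x := usubmx z in let u := dsubmx z in
  f x + dotv yk (A *m x + b - u) + rho / 2 * enorm (A *m x + b - u) ^+ 2
  + mu / 2 * enorm (x - xk) ^+ 2.

(* The case is decided by the limit of the infinite inner sequence: when its
   x-part is xk, a P-stationary point is taken even if some finite inner
   iterate also passes the tests. *)
Definition inalm_primal (k : nat) xk uk yk (z' : 'cV[R]_(n + m)) : Prop :=
  let g := gk yk xk in
  let ok := inexact g lam alpha c1 c2 (eps k) xk in
  exists2 zeta : nat -> 'cV[R]_(n + m),
    gsnewton_seq g lam alpha t (mu - sigma_f) (col_mx xk uk) zeta &
    let stalls := exists2 zinf, zeta @ \oo --> zinf & usubmx zinf = xk in
    [/\ stalls, P_stationary g lam alpha z' & ok z'] \/
    (~ stalls /\
     exists j, [/\ ok (zeta j), forall i, (i < j)%N -> ~ ok (zeta i)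
                 & z' = zeta j]).

Definition inalm_seq (xs : nat -> 'cV[R]_n) (us ys : nat -> 'cV[R]_m) : Prop :=
  forall k,
  [/\ inalm_primal k (xs k) (us k) (ys k) (col_mx (xs k.+1) (us k.+1)),
      ys k.+1 = ys k + rho *: (A *m xs k.+1 + b - us k.+1) &
      calV mu (xs k.+1) (us k.+1) (ys k) (xs k)
        <= calV mu (xs k) (us k) (ys k) (xs k)].

Definition crit_cone u y : set 'cV[R]_n :=
  [set d | (forall i, u i 0 = 0 -> 0 < y i 0 -> (A *m d) i 0 = 0) /\
           (forall i, u i 0 = 0 -> y i 0 = 0 -> (A *m d) i 0 <= 0)].

Definition SOSC x u y : Prop :=
  forall d, crit_cone u y d -> d != 0 -> 0 < dotv d (hess f x *m d).

End iNALM.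

(* Main.v *)
(* Write D_k = |x^k - x^(k-1)| + |x^(k-1) - x^(k-2)|. The multiplier update
   increases the Lagrangian by |y^(k+1) - y^k|^2 / rho, which the inexactness
   test on grad_x and the full row rank of A bound by the last two primal steps,
   so V decreases by at least (mu / 4) |x^(k+1) - x^k|^2. Lower semicontinuity at
   the accumulation point gives V >= Vstar, hence D_k -> 0.

   Near the accumulation point, the third test (approximate optimality in the
   proximal problem) together with the integrality of h forces u^k and ustar to
   have the same positive entries. The problem then becomes locally the smooth
   program min f(x) subject to (A x + b)_i <= 0 for ustar_i = 0, and the first two
   tests say that (x^k, y^k) is a KKT point of it up to O(D_k). The second-order
   condition and the surjectivity of A give the error bound
   |z^k - zstar| <= C D_k, whence V_k - Vstar <= C D_k^2. Since D_k -> 0, the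
   iterates never leave the neighbourhood, and comparing with the decrease of V
   yields w_(k+2) <= C (w_k - w_(k+2)) for w = V - Vstar, a linear rate. *)

Require Import Defs.
From HB Require Import structures.
From mathcomp Require Import all_boot all_order all_algebra.
From mathcomp Require Import all_classical all_reals all_analysis.
From mathcomp Require Import ring lra.

Set Implicit Arguments.
Unset Strict Implicit.
Unset Printing Implicit Defensive.

Import Order.TTheory GRing.Theory Num.Theory.
Import numFieldNormedType.Exports.

Local Open Scope classical_set_scope.
Local Open Scope ring_scope.

(** * Euclidean inner product and norm on column vectors *)

Section EuclideanTheory.
Variable R : realType.

Lemma dotvE n (u v : 'cV[R]_n) : dotv u v = (u^T *m v) 0 0.
Proof. by rewrite mxE; apply: eq_bigr => i _; rewrite mxE. Qed.

Lemma dotvC n (u v : 'cV[R]_n) : dotv u v = dotv v u.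
Proof. by apply: eq_bigr => i _; rewrite mulrC. Qed.

Lemma dotvDr n (u v w : 'cV[R]_n) : dotv u (v + w) = dotv u v + dotv u w.
Proof. by rewrite !dotvE mulmxDr mxE. Qed.

Lemma dotvZr n a (u v : 'cV[R]_n) : dotv u (a *: v) = a * dotv u v.
Proof. by rewrite !dotvE -scalemxAr mxE. Qed.

Lemma dotvDl n (u v w : 'cV[R]_n) : dotv (v + w) u = dotv v u + dotv w u.
Proof. by rewrite dotvC dotvDr !(dotvC u). Qed.

Lemma dotvZl n a (u v : 'cV[R]_n) : dotv (a *: v) u = a * dotv v u.
Proof. by rewrite dotvC dotvZr dotvC. Qed.

Lemma dotvNr n (u v : 'cV[R]_n) : dotv u (- v) = - dotv u v.
Proof. by rewrite -scaleN1r dotvZr mulN1r. Qed.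

Lemma dotvNl n (u v : 'cV[R]_n) : dotv (- v) u = - dotv v u.
Proof. by rewrite dotvC dotvNr dotvC. Qed.

Definition dotv_linE := (dotvDl, dotvDr, dotvNl, dotvNr, dotvZl, dotvZr).

Lemma dotv0r n (u : 'cV[R]_n) : dotv u 0 = 0.
Proof. by rewrite -(scale0r 0) dotvZr mul0r. Qed.

Lemma dotv_adjoint n m (M : 'M[R]_(m, n)) u v :
  dotv (M *m u) v = dotv u (M^T *m v).
Proof. by rewrite !dotvE trmx_mul mulmxA. Qed.

Lemma dotv_ge0 n (u : 'cV[R]_n) : 0 <= dotv u u.
Proof. by apply: sumr_ge0 => i _; rewrite -expr2 sqr_ge0. Qed.

Lemma enorm_ge0 n (u : 'cV[R]_n) : 0 <= enorm u.
Proof. exact: sqrtr_ge0. Qed.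

Lemma enorm_sqr n (u : 'cV[R]_n) : enorm u ^+ 2 = dotv u u.
Proof. by rewrite sqr_sqrtr ?dotv_ge0. Qed.

Lemma enormZ n a (u : 'cV[R]_n) : enorm (a *: u) = `|a| * enorm u.
Proof.
by rewrite /enorm dotvZl dotvZr mulrA -expr2 sqrtrM ?sqr_ge0// sqrtr_sqr.
Qed.

Lemma enormN n (u : 'cV[R]_n) : enorm (- u) = enorm u.
Proof. by rewrite -scaleN1r enormZ normrN1 mul1r. Qed.

Lemma enorm0 n : enorm (0 : 'cV[R]_n) = 0.
Proof. by rewrite /enorm dotv0r sqrtr0. Qed.

Lemma enorm_coord n (u : 'cV[R]_n) i : `|u i 0| <= enorm u.
Proof.
rewrite -sqrtr_sqr ler_wsqrtr// /dotv (bigD1 i)//= -expr2 lerDl.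
by apply: sumr_ge0 => j _; rewrite -expr2 sqr_ge0.
Qed.

Lemma enorm_eq0 n (u : 'cV[R]_n) : enorm u = 0 -> u = 0.
Proof.
move=> u0; apply/matrixP => i j; rewrite ord1 mxE; apply/eqP.
by rewrite -normr_le0 -u0 enorm_coord.
Qed.

Lemma enorm_gt0 n (u : 'cV[R]_n) : u != 0 -> 0 < enorm u.
Proof.
by move=> u0; rewrite lt0r enorm_ge0 andbT; apply: contraNneq u0 => /enorm_eq0->.
Qed.

(** Expanding the squared norm of [enorm v *: u - enorm u *: v] gives
    [2 |u| |v| (|u| |v| - <u, v>) >= 0], and the positive factor is cancelled. *)
Lemma cauchy_schwarz n (u v : 'cV[R]_n) : dotv u v <= enorm u * enorm v.
Proof.
have [->|v0] := eqVneq v 0; first by rewrite dotv0r enorm0 mulr0.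
have v_gt0 := enorm_gt0 v0.
have := dotv_ge0 (enorm v *: u - enorm u *: v).
rewrite !dotv_linE (dotvC v u) -!enorm_sqr.
have := enorm_ge0 u; rewrite le_eqVlt => /orP[/eqP u0 _|u_gt0 H].
  by rewrite (enorm_eq0 (esym u0)) dotvC dotv0r enorm0 mul0r.
have : 0 <= 2 * (enorm u * enorm v) * (enorm u * enorm v - dotv u v) by lra.
by rewrite pmulr_rge0 ?subr_ge0// mulr_gt0// mulr_gt0.
Qed.

Lemma normr_dotv_le n (u v : 'cV[R]_n) : `|dotv u v| <= enorm u * enorm v.
Proof.
rewrite ler_norml cauchy_schwarz andbT lerNl -dotvNl -(enormN u).
exact: cauchy_schwarz.
Qed.

Lemma enormD n (u v : 'cV[R]_n) : enorm (u + v) <= enorm u + enorm v.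
Proof.
have uv_ge0 : 0 <= enorm u + enorm v by rewrite addr_ge0 ?enorm_ge0.
rewrite -(ler_pXn2r (_ : 0 < 2)%N) ?nnegrE ?enorm_ge0//.
rewrite enorm_sqr !dotv_linE (dotvC v u) -!enorm_sqr.
have := cauchy_schwarz u v; lra.
Qed.

Lemma enormB n (u v : 'cV[R]_n) : enorm (u - v) <= enorm u + enorm v.
Proof. by rewrite -(enormN v) enormD. Qed.

Lemma enorm_distC n (u v : 'cV[R]_n) : enorm (u - v) = enorm (v - u).
Proof. by rewrite -enormN opprB. Qed.

Lemma enorm_le_sum n (u : 'cV[R]_n) : enorm u <= \sum_i `|u i 0|.
Proof.
have s_ge0 (P : pred 'I_n) : 0 <= \sum_(i | P i) `|u i 0| by exact: sumr_ge0.
rewrite -(ler_pXn2r (_ : 0 < 2)%N) ?nnegrE ?enorm_ge0//.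
rewrite enorm_sqr expr2 mulr_suml ler_sum// => i _.
rewrite -expr2 -real_normK ?num_real// expr2 ler_wpM2l//.
by rewrite (bigD1 i)//= lerDl.
Qed.

Lemma enorm_mulmx_le n p (M : 'M[R]_(p, n)) :
  exists2 C, 0 < C & forall u, enorm (M *m u) <= C * enorm u.
Proof.
(* The summand 1 keeps the constant positive when [M] is zero. *)
exists (1 + \sum_i enorm (row i M)^T).
  by rewrite ltr_pwDl// sumr_ge0// => i _; exact: enorm_ge0.
move=> u; apply: le_trans (enorm_le_sum _) _.
rewrite mulrDl mul1r mulr_suml ler_wpDl ?enorm_ge0//; apply: ler_sum => i _.
apply: le_trans (normr_dotv_le _ _); rewrite dotvE trmxK.
by rewrite -row_mul [in leRHS]mxE.
Qed.

End EuclideanTheory.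

(** * Comparison of the Euclidean and sup norms, continuity, and minima on the sphere *)

Section EuclideanTopology.
Variable R : realType.

Lemma mx_norm_le_enorm n (u : 'cV[R]_n) : `|u| <= enorm u.
Proof.
rewrite [leLHS]/Num.norm /= mx_normrE; apply/bigmax_leP; split=> [|[i j] _] /=.
  exact: enorm_ge0.
by rewrite ord1 enorm_coord.
Qed.

Lemma coord_le_mx_norm n (u : 'cV[R]_n) i : `|u i 0| <= `|u|.
Proof.
by rewrite [leRHS]/Num.norm /= mx_normrE; apply/bigmax_geP; right; exists (i, 0).
Qed.

Lemma enorm_le_mx_norm n (u : 'cV[R]_n) : enorm u <= n%:R * `|u|.
Proof.
apply: le_trans (enorm_le_sum _) _; rewrite mulr_natl -[X in _ *+ X]card_ord.
by rewrite -sumr_const; apply: ler_sum => i _; exact: coord_le_mx_norm.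
Qed.

Lemma nbhs_enorm_ball n (x : 'cV[R]_n) (d : R) :
  0 < d -> nbhs x [set z | enorm (z - x) < d].
Proof.
move=> d0; apply/nbhs_ballP; exists (d / (n%:R + 1)) => /=.
  by rewrite divr_gt0 ?ltr_wpDl.
move=> z; rewrite -ball_normE /= distrC ltr_pdivlMr ?ltr_wpDl// => zx.
apply: le_lt_trans (enorm_le_mx_norm _) _; apply: le_lt_trans zx.
by rewrite mulrDr mulr1 mulrC lerDl.
Qed.

Lemma nbhs_enormP n (x : 'cV[R]_n) (P : set 'cV[R]_n) :
  nbhs x P -> exists2 d, 0 < d & forall z, enorm (z - x) < d -> P z.
Proof.
move=> /nbhs_ballP[d /= d0 dP]; exists d => // z zx; apply: dP.
rewrite -ball_normE /= distrC; exact: le_lt_trans (mx_norm_le_enorm _) zx.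
Qed.

Lemma continuous_dotv n (T : topologicalType) (F G : T -> 'cV[R]_n) :
  continuous F -> continuous G -> continuous (fun x => dotv (F x) (G x)).
Proof.
move=> cF cG x.
apply: cvg_big => [|i _]; first exact: add_continuous.
apply: cvgM; apply: (@continuous_comp _ _ _ _ (fun M : 'cV[R]_n => M i 0));
  by [exact: cF|exact: cG|exact: coord_continuous].
Qed.

Lemma continuous_mulmx n p (M : 'M[R]_(p, n)) :
  continuous (fun x : 'cV[R]_n => M *m x).
Proof.
have [C C0 MC] := enorm_mulmx_le M => x P /= /nbhs_enormP[d d0 dP].
have := nbhs_enorm_ball x (divr_gt0 d0 C0); apply: filterS => z /= zx.
apply: dP; rewrite -mulmxBr; apply: le_lt_trans (MC _) _.
by rewrite mulrC -ltr_pdivlMr.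
Qed.

Lemma continuous_enorm n : continuous (@enorm R n).
Proof.
move=> x P /= /nbhs_ballP[d /= d0 dP].
have := nbhs_enorm_ball x d0; apply: filterS => z /= zx; apply: dP.
rewrite -ball_normE /= ltr_norml; apply/andP; split.
  have := enormD (z - x) x; rewrite subrK; lra.
by have := enormD (x - z) z; rewrite subrK enorm_distC; lra.
Qed.

Lemma continuous_trmx n p : continuous (@trmx R n p).
Proof.
move=> x P /= /nbhs_ballP[d /= d0 dP]; apply/nbhs_ballP; exists d => // z.
move=> [_ zx]; apply: dP; split=> // i j; rewrite !mxE; exact: zx.
Qed.

Lemma quadform_min_sphere n (M : 'M[R]_n) (S : set 'cV[R]_n) :
  closed S -> (exists2 v, S v & enorm v = 1) ->
  exists v, [/\ S v, enorm v = 1 &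
    forall w, S w -> enorm w = 1 -> dotv v (M *m v) <= dotv w (M *m w)].
Proof.
move=> cS [v0 Sv0 v01].
(* Compactness and the extreme value theorem are applied to row vectors, hence the transposes. *)
pose K := [set r : 'rV[R]_n | S r^T /\ enorm r^T = 1].
have K0 : K !=set0 by exists v0^T; rewrite /K /= trmxK.
have cK : compact K.
  apply: bounded_closed_compact.
    exists 1; split=> [|e e1 r [_ r1]]; first exact: num_real.
    apply: le_trans (ltW e1); rewrite [leLHS]/Num.norm /= mx_normrE.
    apply/bigmax_leP; split=> // -[i j] _ /=.
    by have := enorm_coord r^T j; rewrite r1 mxE ord1.
  rewrite (_ : K = (@trmx R 1 n) @^-1` (S `&` (@enorm R n) @^-1` [set 1])); last first.
    by apply/seteqP; split.
  apply: preimage_closed; first by move=> ? _; exact: continuous_trmx.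
  apply: closedI => //; apply: preimage_closed => [? _|].
    exact: continuous_enorm.
  exact: closed_eq.
have [|r rK rmin] := EVT_min_rV (f := fun r => dotv r^T (M *m r^T)) K0 cK.
  apply: continuous_subspaceT; apply: continuous_dotv.
    exact: continuous_trmx.
  move=> x; apply: continuous_comp; first exact: continuous_trmx.
  exact: continuous_mulmx.
move: rK; rewrite inE => -[Sr r1]; exists r^T; split => // w Sw w1.
by have := rmin w^T; rewrite trmxK; apply; rewrite inE /K /= trmxK.
Qed.

End EuclideanTopology.

(** * Lower bounds for quadratic forms on cones *)

Section QuadraticForms.
Variable R : realType.

Lemma quadform_unit_lb n (M : 'M[R]_n) (S : set 'cV[R]_n) k :
  (forall a v, 0 < a -> S v -> S (a *: v)) ->
  (forall v, S v -> enorm v = 1 -> k <= dotv v (M *m v)) ->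
  forall v, S v -> k * enorm v ^+ 2 <= dotv v (M *m v).
Proof.
move=> SZ kS v Sv; have [->|v0] := eqVneq v 0.
  by rewrite mulmx0 dotv0r enorm0 expr0n mulr0.
have v_gt0 := enorm_gt0 v0; have vV_gt0 : 0 < (enorm v)^-1 by rewrite invr_gt0.
have := kS _ (SZ _ _ vV_gt0 Sv).
rewrite enormZ gtr0_norm// mulVf ?gt_eqF// => /(_ erefl).
rewrite -scalemxAr dotvZl dotvZr mulrA -expr2 exprVn mulrC.
by rewrite ler_pdivlMr ?exprn_gt0.
Qed.

(** A minimiser [v] of the form on the unit sphere, with value [l0], is an eigenvector: its residual
    [r = M v - l0 v] vanishes, since otherwise moving along [- r] would lower the Rayleigh quotient.
    Thus [l0] is an eigenvalue and [l <= l0]. *)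
Lemma rayleigh_lambda_min n (M : 'M[R]_n) l y :
  M^T = M -> is_lambda_min M l -> l * enorm y ^+ 2 <= dotv y (M *m y).
Proof.
move=> Msym [_ lmin]; have [->|y0] := eqVneq y 0.
  by rewrite mulmx0 dotv0r enorm0 expr0n mulr0.
have y_gt0 := enorm_gt0 y0.
have [|v [_ v1 vmin]] := quadform_min_sphere M (@closedT _).
  exists ((enorm y)^-1 *: y) => //.
  by rewrite enormZ gtr0_norm ?invr_gt0// mulVf// gt_eqF.
set l0 := dotv v (M *m v) in vmin.
have lb w : l0 * enorm w ^+ 2 <= dotv w (M *m w).
  by apply: (quadform_unit_lb (S := setT)) => // u _; exact: vmin.
have [r rdef] : exists r, r = M *m v - l0 *: v by exists (M *m v - l0 *: v).
suff r0 : r = 0.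
  have Mv : v^T *m M = l0 *: v^T.
    apply: trmx_inj; rewrite trmx_mul trmxK Msym linearZ /= trmxK.
    by apply/eqP; rewrite -subr_eq0 -rdef r0.
  apply: le_trans (lb y); rewrite ler_wpM2r ?sqr_ge0//; apply: lmin.
  apply/eigenvalueP; exists v^T => //; apply/negP => /eqP vT0.
  have /eqP := v1; rewrite -[v]trmxK vT0 trmx0 enorm0.
  by rewrite eq_sym oner_eq0.
pose q := dotv r (M *m r) - l0 * enorm r ^+ 2.
have q_ge0 : 0 <= q by rewrite subr_ge0.
(* The bound [lb] at [v - s *: r]: the terms of order 0 in [s] cancel because [enorm v = 1]. *)
have expand s : 2 * s * enorm r ^+ 2 <= s ^+ 2 * q.
  have := lb (v - s *: r); rewrite -subr_ge0 enorm_sqr mulmxBr -scalemxAr.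
  have rE : dotv r (M *m v) = enorm r ^+ 2 + l0 * dotv v r.
    by rewrite enorm_sqr {3}rdef !dotv_linE (dotvC v r) subrK.
  rewrite !dotv_linE -(dotvC (M *m r)) dotv_adjoint Msym (dotvC r v).
  rewrite -/l0 -!enorm_sqr v1 rE /q; lra.
apply: enorm_eq0; apply/eqP; rewrite -sqrf_eq0 eq_le sqr_ge0 andbT.
rewrite leNgt; apply/negP => r_gt0.
have q1 : 0 < 1 + q by lra.
(* With this [s] the first-order term dominates; the [1 +] avoids a division by zero when
   [q = 0]. *)
have := expand (enorm r ^+ 2 / (1 + q)).
set e := _ ^+ 2 in r_gt0 *.
rewrite -subr_ge0 (_ : _ - _ = - (e / (1 + q)) ^+ 2 * (2 + q)); last first.
  by field; rewrite gt_eqF.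
by rewrite mulNr oppr_ge0 leNgt mulr_gt0 ?exprn_gt0 ?divr_gt0//; lra.
Qed.

(** The minimum over the compact set of unit vectors of [S] is attained, hence positive, and
    homogeneity carries it to all of [S]. *)
Lemma pos_def_closed_cone n (H : 'M[R]_n) (S : set 'cV[R]_n) :
  closed S -> (forall a v, 0 < a -> S v -> S (a *: v)) ->
  (forall v, S v -> v != 0 -> 0 < dotv v (H *m v)) ->
  exists2 k, 0 < k & forall v, S v -> k * enorm v ^+ 2 <= dotv v (H *m v).
Proof.
move=> cS SZ Hpos.
have [ne|empty] := pselect (exists2 v, S v & enorm v = 1).
  have [v [Sv v1 vmin]] := quadform_min_sphere H cS ne.
  exists (dotv v (H *m v)); last exact: quadform_unit_lb.
  apply: Hpos => //; apply/eqP => v0.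
  by have /eqP := v1; rewrite v0 enorm0 eq_sym oner_eq0.
(* Without unit vectors in [S] the bound on the sphere is vacuous, so any constant will do. *)
exists 1 => // ; apply: quadform_unit_lb => // v Sv v1.
by case: empty; exists v.
Qed.

(* Young's inequality absorbs the cross terms in [e' = e - Q w]. *)
Lemma pos_def_near_cone n p (H : 'M[R]_n) (Q : 'M[R]_(n, p)) k :
  0 < k -> exists2 C, 0 < C & forall e w,
    let e' := e - Q *m w in
    k * enorm e' ^+ 2 <= dotv e' (H *m e') ->
    k / 4 * enorm e ^+ 2 <= dotv e (H *m e) + C * enorm w ^+ 2.
Proof.
move=> k0; have [h h0 hH] := enorm_mulmx_le H.
have [q q0 qQ] := enorm_mulmx_le Q.
exists (k * q ^+ 2 + h * q ^+ 2 + 4 * (h * q) ^+ 2 / k).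
  by rewrite ltr_wpDr ?divr_ge0 ?mulr_ge0 ?sqr_ge0// ?ltr_wpDr// ?(ltW k0)//
     ?mulr_gt0 ?mulr_ge0 ?exprn_gt0 ?exprn_ge0// ltW.
move=> e w e'; rewrite /e'; set d := Q *m w => Hk.
have d_le : enorm d <= q * enorm w by exact: qQ.
have he : enorm (H *m e) <= h * enorm e by [].
have hd : enorm (H *m d) <= h * enorm d by [].
have e0 := enorm_ge0 e; have w0 := enorm_ge0 w; have d0 := enorm_ge0 d.
have qw0 : 0 <= q * enorm w by rewrite mulr_ge0 ?(ltW q0).
have ehd : - (enorm e * (h * (q * enorm w))) <= dotv e (H *m d).
  have := normr_dotv_le e (H *m d); rewrite ler_norml => /andP[+ _].
  apply: le_trans; rewrite lerN2 ler_wpM2l//; apply: le_trans hd _.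
  by rewrite ler_wpM2l// ltW.
have dhe : - (q * enorm w * (h * enorm e)) <= dotv d (H *m e).
  have := normr_dotv_le d (H *m e); rewrite ler_norml => /andP[+ _].
  by apply: le_trans; rewrite lerN2 ler_pM ?enorm_ge0.
have dhd : dotv d (H *m d) <= q * enorm w * (h * (q * enorm w)).
  apply: le_trans (cauchy_schwarz _ _) _; rewrite ler_pM ?enorm_ge0//.
  by apply: le_trans hd _; rewrite ler_wpM2l// ltW.
have half : enorm e ^+ 2 <= 2 * enorm (e - d) ^+ 2 + 2 * (q * enorm w) ^+ 2.
  have tri : enorm e <= enorm (e - d) + enorm d.
    by rewrite -{1}(subrK d e) enormD.
  have ed0 := enorm_ge0 (e - d).
  have : enorm e ^+ 2 <= (enorm (e - d) + q * enorm w) ^+ 2.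
    by rewrite ler_pXn2r ?nnegrE//; lra.
  have := sqr_ge0 (enorm (e - d) - q * enorm w); lra.
have young : 2 * (h * q) * (enorm e * enorm w) <=
    k / 4 * enorm e ^+ 2 + 4 * (h * q) ^+ 2 / k * enorm w ^+ 2.
  rewrite -subr_ge0 (_ : _ - _ =
    (k * enorm e / 2 - 2 * (h * q) * enorm w) ^+ 2 / k); last first.
    by field; rewrite gt_eqF.
  by rewrite divr_ge0 ?sqr_ge0// ltW.
have := ler_wpM2l (ltW k0) half.
move: Hk; rewrite mulmxBr !dotv_linE => Hk; lra.
Qed.

End QuadraticForms.

(** * Gradient, Hessian and first-order expansions *)

Section Calculus.
Variable R : realType.

Lemma derive_sum_basis n (W : normedModType R) (F : 'cV[R]_n -> W) x v :
  differentiable F x ->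
  'D_v F x = \sum_j v j 0 *: 'D_(delta_mx j 0) F x.
Proof.
move=> dF; rewrite deriveE// {1}[v]matrix_sum_delta linear_sum.
apply: eq_bigr => j _.
by rewrite big_ord_recl big_ord0 addr0 linearZ deriveE.
Qed.

Lemma derive_grad n (f : 'cV[R]_n -> R) x v :
  differentiable f x -> 'D_v f x = dotv (grad f x) v.
Proof.
move=> df; rewrite derive_sum_basis//; apply: eq_bigr => j _.
by rewrite mxE [RHS]mulrC.
Qed.

Lemma derive_grad_hess n (f : 'cV[R]_n -> R) x v :
  differentiable (grad f) x -> 'D_v (grad f) x = hess f x *m v.
Proof.
move=> df; rewrite derive_sum_basis//; apply/matrixP => i k.
rewrite summxE [RHS]mxE ord1; apply: eq_bigr => j _.
have gradE : (fun z => grad f z i 0) = (fun z => 'D_(delta_mx i 0) f z).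
  by apply/funext => z; rewrite mxE.
rewrite derive_mx; last exact: diff_derivable.
rewrite [LHS]mxE [in LHS]mxE gradE [in RHS]mxE; exact: mulrC.
Qed.

Lemma grad_expansion n (f : 'cV[R]_n -> R) x eta :
  differentiable (grad f) x -> 0 < eta ->
  exists2 r, 0 < r & forall e, enorm e < r ->
    enorm (grad f (x + e) - grad f x - hess f x *m e) <= eta * enorm e.
Proof.
move=> df eta0; have n1 : 0 < n%:R + 1 :> R by rewrite ltr_wpDl.
have /eqaddoP dlE : (fun h => grad f (x + h)) =
    (cst (grad f x) + 'd (grad f) x : _ -> _) +o_ (0 : 'cV[R]_n) id.
  by apply/funext => h; exact: diff_locallyxC.
(* The little-o is measured in the sup norm; dividing [eta] by [n + 1] pays for the factor [n] lost
   on returning to [enorm]. *)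
have := dlE _ (divr_gt0 eta0 n1).
rewrite nearE => /nbhs_enormP[r r0 rP]; exists r => // e er.
have := rP e; rewrite subr0 => /(_ er) /=.
rewrite [X in `|X| <= _](_ : _ = grad f (x + e) - grad f x - hess f x *m e).
  move=> H; apply: le_trans (enorm_le_mx_norm _) _.
  apply: le_trans (_ : (n%:R + 1) * `|grad f (x + e) - grad f x - hess f x *m e| <= _).
    by rewrite ler_wpM2r// lerDl.
  rewrite mulrC -ler_pdivlMr//; apply: le_trans H _.
  by rewrite mulrAC ler_wpM2r ?invr_ge0 ?(ltW n1)// ler_wpM2l ?mx_norm_le_enorm ?ltW.
by rewrite -derive_grad_hess// deriveE// -addrA -opprD.
Qed.

(** The mean value theorem on the segment from [x] to [x + e] leaves
    [<grad f (x + c e) - grad f x, e>] with [c] in (0, 1). The absolute value on [l] spares a sign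
    assumption; the sharper factor 1/2 is not sought. *)
Lemma taylor_lipschitz_grad n (f : 'cV[R]_n -> R) l x e :
  (forall z, differentiable f z) -> lipschitz_vec l (grad f) ->
  `|f (x + e) - f x - dotv (grad f x) e| <= `|l| * enorm e ^+ 2.
Proof.
move=> df lipf; pose phi (s : R) := f (x + s *: e).
have dphi (s : R) : is_derive s (1 : R) phi (dotv (grad f (x + s *: e)) e).
  (* The difference quotient of [phi] at [s] is that of [f] at [x + s *: e] in the direction [e]. *)
  have E : (fun h : R => h^-1 *: ((phi \o shift s) (h *: 1) - phi s)) =
      fun h => h^-1 *: ((f \o shift (x + s *: e)) (h *: e) - f (x + s *: e)).
    apply/funext => h; rewrite /phi /=; congr (_ *: (f _ - _)).
    by rewrite [_ *: 1]mulr1 scalerDl addrCA.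
  rewrite -derive_grad//; apply: DeriveDef; rewrite /derivable /derive E//.
  exact: diff_derivable.
have [|c] := @MVT R phi (fun s => dotv (grad f (x + s *: e)) e) 0 1 ltr01.
  by apply: derivable_within_continuous => s _; exact: ex_derive.
rewrite in_itv /= => /andP[c0 c1].
rewrite /phi scale1r scale0r addr0 subr0 mulr1 => ->.
rewrite -dotvNl -dotvDl; apply: le_trans (normr_dotv_le _ _) _.
rewrite expr2 mulrA ler_wpM2r ?enorm_ge0//; apply: le_trans (lipf _ _) _.
rewrite addrAC subrr add0r enormZ; apply: le_trans (_ : `|l| * (`|c| * enorm e) <= _).
  by rewrite ler_wpM2r ?mulr_ge0 ?enorm_ge0// ler_norm.
rewrite ler_wpM2l// ler_piMl ?enorm_ge0// gtr0_norm//; exact: ltW.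
Qed.

(** The difference quotient is exactly [a + h * q]. This reads the derivative of the penalty terms
    off their expansion, without a chain rule. *)
Lemma derive_quadratic (V : normedModType R) (G : V -> R) z v a q :
  (forall s, G (s *: v + z) = G z + s * a + s ^+ 2 * q) -> is_derive z v G a.
Proof.
move=> GE.
have lim_a : h^-1 *: ((G \o shift z) (h *: v) - G z) @[h --> 0^'] --> a.
  have : a + h * q @[h --> (0 : R)^'] --> a + 0 * q.
    apply: cvgD; first exact: cvg_cst.
    apply: cvgM; last exact: cvg_cst.
    apply: cvg_within.
  rewrite mul0r addr0; apply: cvg_trans; apply: near_eq_cvg.
  near=> h; rewrite /= GE.
  have h0 : h != 0 by near: h; exact: nbhs_dnbhs_neq.
  by rewrite /GRing.scale /=; field.
apply: DeriveDef; last exact: cvg_lim.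
by apply/cvg_ex; exists a.
Unshelve. all: end_near. Qed.

End Calculus.

Lemma dotv_delta (R : realType) n (u : 'cV[R]_n) i : dotv u (delta_mx i 0) = u i 0.
Proof.
rewrite /dotv (bigD1 i)//= big1 => [|j /negbTE ji]; rewrite mxE ?ji ?mulr0//.
by rewrite !eqxx mulr1 addr0.
Qed.

(** * Partial gradients of the inner objective *)

Section AugmentedLagrangianGradient.
Variables (R : realType) (n m : nat).
Variables (f : 'cV[R]_n -> R) (A : 'M[R]_(m, n)) (b : 'cV[R]_m).
Variables (mu rho : R) (yk : 'cV[R]_m) (xk : 'cV[R]_n).
Hypothesis df : forall x, differentiable f x.

Lemma derive_gk x u (v : 'cV[R]_(n + m)) :
  'D_v (gk f A b mu rho yk xk) (col_mx x u) =
    dotv (grad f x + A^T *m (yk + rho *: (A *m x + b - u)) + mu *: (x - xk))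
         (usubmx v)
    - dotv (yk + rho *: (A *m x + b - u)) (dsubmx v).
Proof.
set vx := usubmx v; set vu := dsubmx v.
(* [G] is the part of [gk] that is polynomial of degree at most 2; only [f] needs
   differentiability. *)
pose G (z : 'cV[R]_(n + m)) :=
  dotv yk (A *m usubmx z + b - dsubmx z) +
  (rho / 2 * enorm (A *m usubmx z + b - dsubmx z) ^+ 2 +
   mu / 2 * enorm (usubmx z - xk) ^+ 2).
rewrite (_ : gk _ _ _ _ _ _ _ = (f \o usubmx) + G); last first.
  by apply/funext => z; rewrite /gk !fctE /G /= !addrA.
have dF : is_derive (col_mx x u) v (f \o usubmx) (dotv (grad f x) vx).
  have E : (fun h : R => h^-1 *: ((f \o usubmx \o shift (col_mx x u)) (h *: v)
      - (f \o usubmx) (col_mx x u))) =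
      fun h => h^-1 *: ((f \o shift x) (h *: vx) - f x).
    apply/funext => h /=.
    have -> : usubmx (h *: v + col_mx x u) = h *: vx + x.
      by rewrite linearD linearZ /= col_mxKu.
    by rewrite col_mxKu.
  rewrite -derive_grad//; apply: DeriveDef; rewrite /derivable /derive E//.
  exact: diff_derivable.
set r := A *m x + b - u; pose w := A *m vx - vu.
have dG : is_derive (col_mx x u) v G
    (dotv yk w + rho * dotv r w + mu * dotv (x - xk) vx).
  apply: (derive_quadratic (q := rho / 2 * enorm w ^+ 2 + mu / 2 * enorm vx ^+ 2)).
  move=> s; rewrite /G col_mxKu col_mxKd -/r.
  have -> : usubmx (s *: v + col_mx x u) = s *: vx + x.
    by rewrite linearD linearZ /= col_mxKu.
  have -> : dsubmx (s *: v + col_mx x u) = s *: vu + u.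
    by rewrite linearD linearZ /= col_mxKd.
  have -> : A *m (s *: vx + x) + b - (s *: vu + u) = r + s *: w.
    rewrite /r /w mulmxDr -scalemxAr scalerBr.
    by apply/matrixP => i j; rewrite !mxE; ring.
  have -> : s *: vx + x - xk = x - xk + s *: vx by rewrite -addrA addrC.
  move: (x - xk) r w => p r w.
  rewrite !enorm_sqr !dotvDr !dotvDl !dotvZr !dotvZl.
  by rewrite (dotvC w r) (dotvC vx p); field.
have -> := @derive_val _ _ _ _ _ _ _ (is_deriveD dF dG).
rewrite {dG} /w; move: (x - xk) r => p r.
rewrite !dotv_linE !dotv_adjoint trmxK !dotv_linE; ring.
Qed.

(** At the accepted point, [yk + rho *: (A *m x + b - u)] is the updated multiplier, so both partial
    gradients are expressed through the next dual iterate. *)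
Lemma gradx_gk x u : gradx (gk f A b mu rho yk xk) (col_mx x u) =
  grad f x + A^T *m (yk + rho *: (A *m x + b - u)) + mu *: (x - xk).
Proof.
apply/matrixP => i j; rewrite ord1 /gradx mxE [LHS]mxE derive_gk.
have -> : usubmx (delta_mx (lshift m i) 0 : 'cV[R]_(n + m)) = delta_mx i 0.
  by apply/matrixP => k l; rewrite !mxE (inj_eq (@lshift_inj _ _)).
have -> : dsubmx (delta_mx (lshift m i) 0 : 'cV[R]_(n + m)) = 0.
  by apply/matrixP => k l; rewrite !mxE eq_rlshift.
by rewrite dotv0r subr0 dotv_delta.
Qed.

Lemma gradu_gk x u : gradu (gk f A b mu rho yk xk) (col_mx x u) =
  - (yk + rho *: (A *m x + b - u)).
Proof.
apply/matrixP => i j; rewrite ord1 /gradu mxE [LHS]mxE derive_gk.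
have -> : usubmx (delta_mx (rshift n i) 0 : 'cV[R]_(n + m)) = 0.
  by apply/matrixP => k l; rewrite !mxE eq_lrshift.
have -> : dsubmx (delta_mx (rshift n i) 0 : 'cV[R]_(n + m)) = delta_mx i 0.
  by apply/matrixP => k l; rewrite !mxE (inj_eq (@rshift_inj _ _)).
by rewrite dotv0r sub0r dotv_delta [RHS]mxE.
Qed.

End AugmentedLagrangianGradient.

(** * Error bound at a KKT point satisfying the second-order condition *)

Section KKTErrorBound.
Variables (R : realType) (n m : nat).
Variables (f : 'cV[R]_n -> R) (A : 'M[R]_(m, n)) (b : 'cV[R]_m) (ell : R).
Variables (x0 : 'cV[R]_n) (u0 y0 : 'cV[R]_m).

Lemma closed_crit_cone : closed (crit_cone A u0 y0).
Proof.
(* The premise does not depend on [d], so the set is either [S] or the whole space. *)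
have closed_imp (P : Prop) (S : set 'cV[R]_n) : closed S -> closed [set d | P -> S d].
  move=> cS; have [p|np] := pselect P.
    by rewrite (_ : mkset _ = S)//; apply/seteqP; split=> d; [apply|move=> + _].
  by rewrite (_ : mkset _ = setT); [exact: closedT|apply/seteqP; split=> // d _ /np].
have cA i : continuous (fun d : 'cV[R]_n => (A *m d) i 0).
  move=> d; apply: (continuous_comp (g := fun M : 'cV[R]_m => M i 0)).
    exact: continuous_mulmx.
  exact: coord_continuous.
rewrite (_ : crit_cone A u0 y0 =
  \bigcap_i ([set d | u0 i 0 = 0 -> (0 < y0 i 0 -> (A *m d) i 0 = 0)] `&`
             [set d | u0 i 0 = 0 -> (y0 i 0 = 0 -> (A *m d) i 0 <= 0)])); last first.
  apply/seteqP; split=> d => [[dE dI] i _|dS].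
    by split=> ? ?; [exact: dE|exact: dI].
  by split=> i; have [] := dS i Logic.I.
apply: closed_bigI => i _; apply: closedI.
  apply: (closed_imp _ [set d | 0 < y0 i 0 -> (A *m d) i 0 = 0]).
  apply: (closed_imp _ [set d | (A *m d) i 0 = 0]).
  apply: (@preimage_closed _ _ _ [set 0 : R]); last exact: closed_eq.
  by move=> ? _; exact: cA.
apply: (closed_imp _ [set d | y0 i 0 = 0 -> (A *m d) i 0 <= 0]).
apply: (closed_imp _ [set d | (A *m d) i 0 <= 0]).
apply: (@preimage_closed _ _ _ [set x : R | x <= 0]); last exact: closed_le.
by move=> ? _; exact: cA.
Qed.

(** If the bound failed then [D <= E], so [c * D ^+ 2 <= c * (E * D)] and one factor [E] cancels. It
    turns the quadratic growth estimate into a linear error bound. *)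
Lemma quadratic_absorb (k a c E D : R) :
  0 < k -> 0 <= a -> 0 <= c -> 0 <= E -> 0 <= D ->
  k * E ^+ 2 <= a * E * D + c * D ^+ 2 -> E <= ((a + c) / k + 1) * D.
Proof.
move=> k0 a0 c0 E0 D0 H; rewrite leNgt; apply/negP => EgtD.
have ak0 : 0 <= (a + c) / k by rewrite divr_ge0 ?addr_ge0// ltW.
have DE : D <= E by apply: ltW; apply: le_lt_trans EgtD; rewrite ler_peMl//; lra.
have E_gt0 : 0 < E by apply: le_lt_trans EgtD; rewrite mulr_ge0//; lra.
have cDE : c * D ^+ 2 <= c * (E * D) by rewrite expr2 ler_wpM2l// ler_wpM2r.
have : k * E * E <= (a + c) * D * E by lra.
rewrite ler_pM2r// -ler_pdivlMl// => kE.
have : (a + c) / k * D < E by apply: le_lt_trans EgtD; rewrite ler_wpM2r//; lra.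
by rewrite ltNge (le_trans kE)// mulrA [_^-1 * _]mulrC.
Qed.

Hypotheses (df : forall x, differentiable f x)
  (dgrad : differentiable (grad f) x0) (lipf : lipschitz_vec ell (grad f))
  (Afree : row_free A).
Hypotheses (feas : A *m x0 + b = u0) (stat : grad f x0 + A^T *m y0 = 0)
  (sosc : SOSC f A x0 u0 y0).

(** Pairing [e = x - x0] with the gradient difference leaves only terms of size [|e| D] or [D ^+ 2],
    while [e] lies within O(D) of the critical cone, where the Hessian is definite. This bounds
    [|e|]; the bounds on [u] and [y] follow from feasibility and from the injectivity of [A^T]. *)
Lemma kkt_error_bound K : 0 <= K ->
  exists r C, [/\ 0 < r, 0 < C & forall x u y D,
    enorm (x - x0) < r -> 0 <= D <= 1 ->
    enorm (grad f x + A^T *m y) <= K * D ->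
    enorm (A *m x + b - u) <= K * D ->
    (forall i, `|u i 0 - u0 i 0| <= 1 /\ `|y i 0 - y0 i 0| <= 1) ->
    (forall i, u0 i 0 = 0 -> u i 0 <= 0) ->
    (forall i, u0 i 0 = 0 /\ `|u i 0| <= K * D ^+ 2 \/
               y0 i 0 = 0 /\ `|y i 0| <= K * D ^+ 2) ->
    [/\ enorm (x - x0) <= C * D, enorm (u - u0) <= C * D,
        enorm (y - y0) <= C * D &
        f x - f x0 + dotv y (A *m x + b - u) <= C * D ^+ 2]].
Proof.
move=> K0.
have [k k0 kcone] : exists2 k, 0 < k & forall v, crit_cone A u0 y0 v ->
    k * enorm v ^+ 2 <= dotv v (hess f x0 *m v).
  apply: pos_def_closed_cone; [exact: closed_crit_cone| |exact: sosc].
  move=> a v a0 [vE vI]; split=> i ui yi; rewrite -scalemxAr mxE.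
    by rewrite vE// mulr0.
  by rewrite pmulr_rle0// vI.
(* [P] serves twice: as a right inverse of [A] it corrects [e] into the cone, and [P^T] recovers
   [y - y0] from its image under [A^T]. *)
pose P := pinvmx A; have AP : A *m P = 1%:M by exact: mulmxVp.
have [Cp Cp0 pP] := enorm_mulmx_le P^T.
have [Ca Ca0 aA] := enorm_mulmx_le A.
have [Cq Cq0 near] := pos_def_near_cone (hess f x0) P k0.
(* The tolerance [k / 8] is half of the [k / 4] kept by [pos_def_near_cone]; the other half is the
   coefficient left in front of [enorm e ^+ 2]. *)
have [r r0 rP] := grad_expansion dgrad (divr_gt0 k0 (ltr0Sn R 7)).
pose l := `|ell|; have l0 : 0 <= l by rewrite normr_ge0.
(* [a1] and [a2] are the coefficients of [|e| D] and [D ^+ 2] in the final quadratic inequality;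
   [C0], [C1], [C2], [C3] bound [x], [u], [y] and the value, in this order. *)
pose a1 := K + K * Cp * l.
pose a2 := m%:R * K + K ^+ 2 * Cp + Cq * (m%:R * (2 * K)) ^+ 2.
pose C0 := (a1 + a2) / (k / 8) + 1.
pose C1 := Ca * C0 + K; pose C2 := Cp * (K + l * C0).
pose C3 := C2 * K + enorm y0 * (m%:R * K) + l * C0 ^+ 2.
have m0 : 0 <= m%:R :> R by [].
have KCp : 0 <= K * Cp by rewrite mulr_ge0// ltW.
have a10 : 0 <= a1 by rewrite /a1 addr_ge0// mulr_ge0.
have a20 : 0 <= a2 by rewrite /a2 !addr_ge0 ?mulr_ge0 ?sqr_ge0// ltW.
have k8 : 0 < k / 8 by rewrite divr_gt0.
have C00 : 0 < C0 by rewrite /C0 ltr_wpDl// divr_ge0 ?(ltW k8)// addr_ge0.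
have C10 : 0 <= C1 by rewrite /C1 addr_ge0// mulr_ge0// ltW.
have C20 : 0 <= C2 by rewrite /C2 mulr_ge0 ?addr_ge0 ?mulr_ge0// ltW.
have C30 : 0 <= C3.
  apply: addr_ge0; last exact: mulr_ge0 l0 (sqr_ge0 _).
  apply: addr_ge0; first exact: mulr_ge0.
  by rewrite mulr_ge0 ?enorm_ge0// mulr_ge0.
exists r, (C0 + C1 + C2 + C3); split => //.
  by do 3![rewrite ltr_wpDr//].
move=> x u y D xr /andP[D0 D1] statD feasD near1 usgn comp.
have [e eE] : exists e, x - x0 = e by exists (x - x0).
have [v vE] : exists v, y - y0 = v by exists (y - y0).
have [p pE] : exists p, A *m x + b - u = p by exists (A *m x + b - u).
have [w0 wE] : exists w0, grad f x + A^T *m y = w0.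
  by exists (grad f x + A^T *m y).
rewrite eE in xr *; rewrite vE pE; rewrite pE in feasD; rewrite wE in statD.
have D2 : D ^+ 2 <= D by rewrite expr2 ler_piMl.
have KD0 : 0 <= K * D by rewrite mulr_ge0.
have e0 := enorm_ge0 e; have v0 := enorm_ge0 v.
have xE : x = x0 + e by rewrite -eE addrC subrK.
have AeE : A *m e = (u - u0) + p.
  by rewrite -pE -feas -eE mulmxBr; apply/matrixP => i j; rewrite !mxE; ring.
have gE : grad f x - grad f x0 = w0 - A^T *m v.
  have -> : grad f x0 = - (A^T *m y0) by apply/eqP; rewrite -addr_eq0 stat.
  by rewrite -wE -vE mulmxBr; apply/matrixP => i j; rewrite !mxE; ring.
have innerE : dotv e (grad f x - grad f x0) =
    dotv e w0 - dotv (u - u0) v - dotv p v.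
  by rewrite gE dotvDr dotvNr -dotv_adjoint AeE dotvDl opprD addrA.
have vle : enorm v <= Cp * (K * D + l * enorm e).
  have -> : v = P^T *m (A^T *m v) by rewrite mulmxA -trmx_mul AP trmx1 mul1mx.
  apply: le_trans (pP _) _; rewrite ler_wpM2l ?(ltW Cp0)//.
  have -> : A^T *m v = w0 - (grad f x - grad f x0) by rewrite gE subKr.
  apply: le_trans (enormB _ _) _; rewrite lerD//; apply: le_trans (lipf _ _) _.
  by rewrite eE ler_wpM2r// ler_norm.
have sum_le (F : 'I_m -> R) c : (forall i, F i <= c) -> \sum_i F i <= m%:R * c.
  move=> Fc; rewrite mulr_natl -[X in _ *+ X]card_ord -sumr_const.
  by apply: ler_sum => i _.
(* Near complementarity: in each coordinate one factor is at most [K * D ^+ 2] and the other at most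
   1. *)
have compl : `|dotv (u - u0) v| <= m%:R * (K * D ^+ 2).
  apply: le_trans (ler_norm_sum _ _ _) _; apply: sum_le => i; rewrite normrM.
  have [u1 v1] := near1 i; rewrite -vE !mxE.
  have [[ui uD]|[yi yD]] := comp i.
    by rewrite ui subr0 -[leRHS]mulr1 ler_pM.
  by rewrite yi subr0 -[leRHS]mul1r ler_pM.
(* [z] is the violation by [e] of the constraints of the critical cone, so that
   [e - P *m z] belongs to it. *)
pose z : 'cV[R]_m := \col_i (if u0 i 0 == 0 then
  if 0 < y0 i 0 then (A *m e) i 0 else Num.max ((A *m e) i 0) 0 else 0).
have zle : enorm z <= m%:R * (2 * K) * D.
  apply: le_trans (enorm_le_sum _) _; rewrite -mulrA; apply: sum_le => i.
  have pi : `|p i 0| <= K * D by apply: le_trans (enorm_coord _ _) feasD.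
  rewrite mxE; case: eqP => ui; last by rewrite normr0 -mulrA mulr_ge0.
  have AeiE : (A *m e) i 0 = u i 0 + p i 0 by rewrite AeE !mxE ui subr0.
  have KD2 : K * D ^+ 2 <= K * D by rewrite ler_wpM2l.
  have ule := usgn i ui.
  (* If [u i 0] is small, both definitions of [z] are bounded directly. Otherwise [y0 i 0 = 0], only
     the positive part of [A *m e] counts, and [u i 0 <= 0] bounds it by [p]. *)
  have [[_ uD]|[-> _]] := comp i.
    have : `|(A *m e) i 0| <= 2 * K * D.
      by rewrite AeiE; apply: le_trans (ler_normD _ _) _; lra.
    case: ifP => // _; rewrite !ler_norml => /andP[? ?].
    by apply/andP; split; [rewrite le_max; apply/orP; right|rewrite ge_max]; lra.
  rewrite ltxx AeiE ger0_norm ?le_max ?lexx ?orbT// ge_max.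
  by move: pi; rewrite ler_norml => /andP[? ?]; apply/andP; split; lra.
have zcone : crit_cone A u0 y0 (e - P *m z).
  have AzE i : (A *m (e - P *m z)) i 0 = (A *m e) i 0 - z i 0.
    by rewrite mulmxBr mulmxA AP mul1mx !mxE.
  split=> i ui yi; rewrite AzE [z i 0]mxE ui eqxx yi ?ltxx ?subrr//.
  by rewrite subr_le0 le_max lexx.
have := near e z (kcone _ zcone).
have rem : dotv e (hess f x0 *m e) <=
    dotv e (grad f x - grad f x0) + k / 8 * enorm e ^+ 2.
  have := rP e xr; rewrite -xE => remle.
  have := le_trans (normr_dotv_le e _) (ler_wpM2l e0 remle).
  rewrite ler_norml dotvDr dotvNr => /andP[+ _]; lra.
have t1 : dotv e w0 <= enorm e * (K * D).
  by apply: le_trans (cauchy_schwarz _ _) _; rewrite ler_wpM2l.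
have t2 : - dotv (u - u0) v <= m%:R * (K * D ^+ 2).
  by move: compl; rewrite ler_norml => /andP[? _]; rewrite lerNl.
have t3' : `|dotv p v| <= K * D * enorm v.
  by apply: le_trans (normr_dotv_le _ _) _; rewrite ler_wpM2r.
have t3 : - dotv p v <= K * D * (Cp * (K * D + l * enorm e)).
  apply: le_trans (ler_wpM2l KD0 vle); rewrite lerNl.
  by move: t3'; rewrite ler_norml => /andP[].
have t4 : Cq * enorm z ^+ 2 <= Cq * (m%:R * (2 * K) * D) ^+ 2.
  rewrite ler_wpM2l ?(ltW Cq0)// ler_pXn2r ?nnegrE ?enorm_ge0//.
  by rewrite !mulr_ge0.
rewrite innerE in rem => Hk.
have ele : enorm e <= C0 * D.
  apply: (quadratic_absorb k8) => //.
  by rewrite /a1 /a2; lra.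
have vle2 : enorm v <= C2 * D.
  apply: le_trans vle _; rewrite /C2 -mulrA ler_wpM2l ?(ltW Cp0)//.
  by rewrite mulrDl -mulrA lerD2l ler_wpM2l.
have ule : enorm (u - u0) <= C1 * D.
  have -> : u - u0 = A *m e - p by rewrite AeE addrK.
  apply: le_trans (enormB _ _) _; rewrite /C1 mulrDl -mulrA lerD//.
  by apply: le_trans (aA _) _; rewrite ler_wpM2l// ltW.
have weaken c d : 0 <= c -> 0 <= d -> d <= C0 + C1 + C2 + C3 -> c <= d * D ->
    c <= (C0 + C1 + C2 + C3) * D.
  by move=> c0 d0 dC; move/le_trans; apply; rewrite ler_wpM2r.
split.
- by apply: weaken ele; rewrite ?(ltW C00)//; lra.
- by apply: weaken ule; rewrite ?enorm_ge0//; lra.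
- by apply: weaken vle2; rewrite //; lra.
have yu : - dotv y0 (u - u0) <= enorm y0 * (m%:R * (K * D ^+ 2)).
  apply: le_trans (ler_norm _) _; rewrite normrN mulrCA.
  apply: le_trans (ler_norm_sum _ _ _) _; apply: sum_le => i; rewrite normrM.
  rewrite !mxE; have [[ui uD]|[-> _]] := comp i.
    by rewrite ui subr0 ler_pM// enorm_coord.
  by rewrite normr0 mul0r !mulr_ge0 ?enorm_ge0 ?sqr_ge0.
have taylor := taylor_lipschitz_grad x0 e df lipf.
rewrite -xE in taylor.
(* The first-order term of [f] contains [- <y0, p>], which cancels against [<y, p>] up to [<p, v>];
   all that remains is of order [D ^+ 2]. *)
have gradeE : dotv (grad f x0) e = - dotv y0 (u - u0) - dotv y0 p.
  have -> : grad f x0 = - (A^T *m y0) by apply/eqP; rewrite -addr_eq0 stat.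
  by rewrite dotvNl dotvC -dotv_adjoint AeE dotvDl !(dotvC y0) opprD.
have yE : dotv y p = dotv y0 p + dotv p v.
  by rewrite -vE (dotvC p) dotvDl dotvNl addrC subrK.
have t5 : dotv p v <= C2 * K * D ^+ 2.
  apply: le_trans (ler_norm _) _; apply: le_trans t3' _.
  have := ler_wpM2l KD0 vle2; lra.
have t6 : l * enorm e ^+ 2 <= l * C0 ^+ 2 * D ^+ 2.
  rewrite -mulrA -exprMn ler_wpM2l// ler_pXn2r ?nnegrE//.
  by rewrite mulr_ge0// ltW.
have D20 : 0 <= D ^+ 2 by rewrite sqr_ge0.
apply: le_trans (_ : C3 * D ^+ 2 <= _); last by rewrite ler_wpM2r//; lra.
move: taylor; rewrite gradeE yE -/l ler_norml => /andP[_]; rewrite /C3; lra.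
Qed.

End KKTErrorBound.

(** * Linear rates, vanishing steps, and supports of vectors *)

Section RealSequences.
Variable R : realType.
Implicit Types (w a : nat -> R).

(** The recursion reads [w j.+2 <= th * w j] with [th = C / (1 + C) < 1], a contraction along each
    parity class. *)
Lemma two_step_linear_rate w C J :
  0 < C -> (forall j, 0 <= w j) ->
  (forall j, (J <= j)%N -> w j.+2 <= C * (w j - w j.+2)) ->
  exists c q, [/\ 0 < c, 0 < q < 1 & forall j, (J <= j)%N -> w j <= c * q ^+ j].
Proof.
move=> C0 w0 wstep; pose th := C / (1 + C); pose q := (1 + th) / 2.
have C1 : 0 < 1 + C by rewrite addr_gt0.
have th0 : 0 < th by rewrite divr_gt0.
have th1 : th < 1 by rewrite ltr_pdivrMr// mul1r ltrDr.
have q0 : 0 < q by rewrite divr_gt0// addr_gt0.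
have q1 : q < 1 by rewrite /q; lra.
(* The arithmetic mean of 1 and [th] replaces the square root of [th] as the rate per step. *)
have thq : th <= q ^+ 2.
  rewrite -subr_ge0 (_ : _ - _ = ((1 - th) / 2) ^+ 2) ?sqr_ge0// /q.
  by field.
have wth j : (J <= j)%N -> w j.+2 <= th * w j.
  move=> /wstep H; rewrite /th mulrAC ler_pdivlMr//; lra.
(* The constant dominates both starting values; the [+ 1] makes it positive. *)
pose c := (w J + w J.+1 + 1) / q ^+ J.+1.
have qJ : 0 < q ^+ J.+1 by rewrite exprn_gt0.
have W0 : 0 < w J + w J.+1 + 1 by rewrite ltr_wpDl// addr_ge0.
have c0 : 0 < c by rewrite divr_gt0.
exists c, q; split; [by []|exact/andP|].
have wJ1 : w J.+1 <= c * q ^+ J.+1.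
  by rewrite divfK ?gt_eqF//; have := w0 J; lra.
have wJ : w J <= c * q ^+ J.
  apply: le_trans (_ : c * q ^+ J.+1 <= _).
    by rewrite divfK ?gt_eqF//; have := w0 J.+1; lra.
  by rewrite ler_wpM2l ?(ltW c0)// exprS ler_piMl ?exprn_ge0// ltW.
suff H i : w (J + i)%N <= c * q ^+ (J + i) /\ w (J + i).+1 <= c * q ^+ (J + i).+1.
  by move=> j /subnKC <-; have [] := H (j - J)%N.
elim: i => [|i [IH1 IH2]]; first by rewrite addn0.
rewrite addnS; split=> //; apply: le_trans (wth _ (leq_addr _ _)) _.
apply: le_trans (ler_wpM2l (ltW th0) IH1) _.
have -> : q ^+ (J + i).+2 = q ^+ 2 * q ^+ (J + i) by rewrite -exprD.
by rewrite mulrCA ler_wpM2l ?(ltW c0)// ler_wpM2r// exprn_ge0// ltW.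
Qed.

(** Once the nonincreasing [w] is within [k * eta ^+ 2] of its infimum, no later drop can reach that
    amount. *)
Lemma summable_steps_vanish w a lb k :
  0 < k -> (forall j, lb <= w j) -> (forall j, 0 <= a j) ->
  (forall j, w j.+1 <= w j - k * a j ^+ 2) ->
  forall eta, 0 < eta -> exists N, forall j, (N <= j)%N -> a j < eta.
Proof.
move=> k0 wlb a0 wdec eta eta0.
have wmono : {homo w : i j / (i <= j)%N >-> j <= i}.
  apply/nonincreasing_seqP => j; apply: le_trans (wdec j) _.
  by rewrite gerBl mulr_ge0 ?sqr_ge0// ltW.
have wl : has_lbound (range w) by exists lb => _ [j _ <-].
have ke : 0 < k * eta ^+ 2 by rewrite mulr_gt0 ?exprn_gt0.
have [_ [N _ <-] wN] : exists2 y, range w y & y < inf (range w) + k * eta ^+ 2.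
  by apply: inf_adherent => //; split=> //; exists (w 0%N), 0%N.
exists N => j Nj; rewrite -(ltr_pXn2r (_ : 0 < 2)%N) ?nnegrE ?(ltW eta0)//.
rewrite -(ltr_pM2l k0).
have : inf (range w) <= w j.+1 by apply: ge_inf => //; exists j.+1.
by have := wdec j; have := wmono _ _ Nj; lra.
Qed.

(** A vector has finitely many nonzero entries; the default 1 covers the zero vector. *)
Lemma coord_gap m (v : 'cV[R]_m) :
  exists2 s, 0 < s & forall i, v i 0 != 0 -> s <= `|v i 0|.
Proof.
exists (\big[Num.min/1]_(i | v i 0 != 0) `|v i 0|).
  by apply: lt_bigmin => // i vi; rewrite normr_gt0.
by move=> i vi; apply: bigmin_le_cond.
Qed.

Lemma h_le m (u v : 'cV[R]_m) : (forall i, 0 < u i 0 -> 0 < v i 0) -> h u <= h v.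
Proof.
move=> uv; rewrite ler_nat; apply: subset_leq_card.
by apply/fintype.subsetP => i /uv.
Qed.

(** [h] takes integer values, so a gap below 1 is none, and nested supports of equal size
    coincide. *)
Lemma h_eq_support m (u v : 'cV[R]_m) : (forall i, 0 < u i 0 -> 0 < v i 0) ->
  h v < h u + 1 -> h v = h u /\ forall i, 0 < v i 0 -> 0 < u i 0.
Proof.
move=> uv; rewrite /h natr1 ltr_nat ltnS => vu.
have /subset_leqif_card[le eq] : [pred i | 0 < u i 0] \subset [pred i | 0 < v i 0].
  by apply/fintype.subsetP => i /uv.
have cE : #|[pred i | 0 < v i 0]| = #|[pred i | 0 < u i 0]|.
  by apply/eqP; rewrite eqn_leq vu le.
split; first by rewrite cE.
have /fintype.subsetP sub : [pred i | 0 < v i 0] \subset [pred i | 0 < u i 0].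
  by rewrite -eq cE.
by move=> i vi; exact: sub.
Qed.

End RealSequences.

(** * Accumulation points of the iterates *)

Section Cluster.
Variable R : realType.

Lemma cluster_frequently (T : topologicalType) (z : nat -> T) p (B : set T) :
  cluster (z @ \oo) p -> nbhs p B -> forall N, exists2 k, (N <= k)%N & B (z k).
Proof.
move=> cl pB N; have [] := cl [set z k | k in [set k | (N <= k)%N]] B => //.
  by exists N => // k Nk; exists k.
by move=> _ [[k Nk <-] Bk]; exists k.
Qed.

Lemma nbhs_triple n m p (x : 'cV[R]_n) (u : 'cV[R]_m) (y : 'cV[R]_p) d :
  0 < d -> nbhs (x, u, y) [set z | [/\ enorm (z.1.1 - x) < d,
    enorm (z.1.2 - u) < d & enorm (z.2 - y) < d]].
Proof.
move=> d0.
exists ([set z | enorm (z.1 - x) < d /\ enorm (z.2 - u) < d],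
        [set z | enorm (z - y) < d]) => /=.
  split; last exact: nbhs_enorm_ball.
  exists ([set z | enorm (z - x) < d], [set z | enorm (z - u) < d]) => //=.
  by split; exact: nbhs_enorm_ball.
by move=> [[x' u'] y'] /= [[? ?] ?].
Qed.

Lemma enorm_small_eq0 n (v : 'cV[R]_n) C : 0 < C ->
  (forall d, 0 < d -> enorm v <= C * d) -> v = 0.
Proof.
move=> C0 vC; apply: enorm_eq0; apply/eqP; rewrite eq_le enorm_ge0 andbT.
by apply/ler_addgt0Pl => e e0; have := vC _ (divr_gt0 e0 C0); rewrite addr0 mulrC divfK ?gt_eqF.
Qed.

End Cluster.

(** With [y'] equal to minus the [u]-gradient of [gk], the tests become statements about the new
    triple. In the third, [Phi] is at most its objective at any trial [w], and
    [alpha ^+ 2 / 2 * enorm y' ^+ 2] cancels after expanding the square. *)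
Lemma inexact_residuals (R : realType) n m (f : 'cV[R]_n -> R) (A : 'M[R]_(m, n)) b
    lam alpha mu rho c1 c2 eps x y (x' : 'cV[R]_n) (u' y' : 'cV[R]_m) :
  (forall x, differentiable f x) -> 0 < lam -> 0 < alpha ->
  y' = y + rho *: (A *m x' + b - u') ->
  inexact (gk f A b mu rho y x) lam alpha c1 c2 eps x (col_mx x' u') ->
  [/\ enorm (grad f x' + A^T *m y' + mu *: (x' - x)) <= c1 * enorm (x' - x),
      forall i, `|u' i 0| <= c2 * enorm (x' - x) ^+ 2 \/
                alpha * `|y' i 0| <= c2 * enorm (x' - x) ^+ 2 &
      forall w, alpha * lam * h u' <= alpha * lam * h w +
        2^-1 * enorm (w - u') ^+ 2 - alpha * dotv (w - u') y' + eps].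
Proof.
move=> df lam0 alpha0 y'E.
have uE : u' - alpha *: - y' = u' + alpha *: y' by rewrite scalerN opprK.
case; rewrite /R1 /R2 /R3 gradx_gk// gradu_gk//.
rewrite !col_mxKu !col_mxKd -y'E uE enormN => r1 r2 r3; split=> //.
- move=> i; have := le_trans (enorm_coord _ i) r2; rewrite mxE.
  case: ifPn => _; first by left.
  by rewrite mxE mulrN normrN normrM gtr0_norm//; right.
- move=> w; have : Phi lam alpha (u' + alpha *: y') <=
      prox_obj lam alpha (u' + alpha *: y') w.
    apply: ge_inf; last by exists w.
    exists 0 => _ [v _ <-]; rewrite addr_ge0// mulr_ge0 ?sqr_ge0//.
    by rewrite mulr_ge0// ltW.
  rewrite /prox_obj opprD addrA.
  have [d ->] : exists d, w - u' = d by exists (w - u').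
  move: r3; rewrite !enorm_sqr !dotv_linE (dotvC y' d); lra.
Qed.

Section LimitPoint.
Variables (R : realType) (n m : nat).
Variables (f : 'cV[R]_n -> R) (A : 'M[R]_(m, n)) (b : 'cV[R]_m) (lam rho : R).
Variables (x0 : 'cV[R]_n) (u0 y0 : 'cV[R]_m).

(** The smooth part is continuous, and [h] cannot drop near [u0] because positive entries stay
    positive there. *)
Lemma calL_lsc eta : (forall x, differentiable f x) -> 0 < lam -> 0 < eta ->
  nbhs (x0, u0, y0) [set z | calL f A b lam rho x0 u0 y0 - eta
                             <= calL f A b lam rho z.1.1 z.1.2 z.2].
Proof.
move=> df lam0 eta0.
pose r (z : 'cV[R]_n * 'cV[R]_m * 'cV[R]_m) := A *m z.1.1 + b - z.1.2.
pose S z := f z.1.1 + dotv z.2 (r z) + rho / 2 * enorm (r z) ^+ 2.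
have c11 : continuous (fun z : 'cV[R]_n * 'cV[R]_m * 'cV[R]_m => z.1.1).
  by move=> z; apply: continuous_comp; exact: cvg_fst.
have c12 : continuous (fun z : 'cV[R]_n * 'cV[R]_m * 'cV[R]_m => z.1.2).
  by move=> z; apply: continuous_comp; [exact: cvg_fst|exact: cvg_snd].
have cr : continuous r.
  move=> z; apply: cvgB; last exact: c12.
  apply: cvgD; last exact: cvg_cst.
  by apply: (continuous_comp (c11 z)); exact: continuous_mulmx.
have cS : {for (x0, u0, y0), continuous S}.
  apply: cvgD; first apply: cvgD.
  - apply: (continuous_comp (f := fun z => z.1.1) (g := f) (c11 (x0, u0, y0))).
    exact: (differentiable_continuous (df _)).
  - by apply: continuous_dotv => // z; exact: cvg_snd.
  - apply: cvgM; first exact: cvg_cst.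
    have ce : continuous (fun v : 'cV[R]_m => enorm v ^+ 2).
      rewrite (_ : (fun v => _) = (fun v => dotv v v)).
        by apply: continuous_dotv => v; exact: cvg_id.
      by apply/funext => v; rewrite enorm_sqr.
    exact: (continuous_comp (cr (x0, u0, y0)) (ce _)).
have nS : nbhs (x0, u0, y0) [set z | S (x0, u0, y0) - eta < S z].
  by apply: (cvgr_gt _ cS); rewrite ltrBlDr ltrDl.
have [s s0 us0] := coord_gap u0.
apply: filterS (filterI nS (nbhs_triple x0 u0 y0 s0)).
move=> [[x u] y] /= [Slt [_ us _]].
have hle : h u0 <= h u.
  apply: h_le => i ui.
  have := us0 i (lt0r_neq0 ui); rewrite gtr0_norm// => sle.
  have := le_lt_trans (enorm_coord _ i) us; rewrite !mxE ltr_norml => /andP[? _].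
  lra.
have := ler_wpM2l (ltW lam0) hle; move: Slt; rewrite /S /r /calL /=; lra.
Qed.

End LimitPoint.

(** * Descent of the Lyapunov function along the iterates *)

Section Iterates.
Variables (R : realType) (n m : nat).
Variables (f : 'cV[R]_n -> R) (A : 'M[R]_(m, n)) (b : 'cV[R]_m).
Variables (lam mu rho ell alpha c1 c2 gamma : R) (eps : nat -> R).
Variables (xs : nat -> 'cV[R]_n) (us ys : nat -> 'cV[R]_m).
Hypotheses (df : forall x, differentiable f x)
  (lipf : lipschitz_vec ell (grad f)).
Hypotheses (lam0 : 0 < lam) (mu0 : 0 < mu) (rho0 : 0 < rho) (alpha0 : 0 < alpha).
Hypotheses (gamma0 : 0 < gamma)
  (gammaP : forall y, gamma * enorm y <= enorm (A^T *m y)).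

Let c3 := (mu + ell + c1) / gamma.
Let c4 := (mu + c1) / gamma.
Let beta := 4 * c4 ^+ 2 / rho.
Let step k := enorm (xs k.+1 - xs k).
(** The index is shifted, [W k] being the value at iterate [k.+1], so that a previous primal iterate
    always exists. *)
Let W k := calV f A b lam rho beta (xs k.+1) (us k.+1) (ys k.+1) (xs k).

Hypothesis rho_large : 8 * (c3 ^+ 2 + c4 ^+ 2) / mu < rho.
Hypothesis dual_update :
  forall k, ys k.+1 = ys k + rho *: (A *m xs k.+1 + b - us k.+1).
Hypothesis residual : forall k,
  enorm (grad f (xs k.+1) + A^T *m ys k.+1 + mu *: (xs k.+1 - xs k)) <= c1 * step k.
Hypothesis primal_descent : forall k,
  calV f A b lam rho mu (xs k.+1) (us k.+1) (ys k) (xs k)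
    <= calV f A b lam rho mu (xs k) (us k) (ys k) (xs k).

Lemma stationarity_residual k :
  enorm (grad f (xs k.+1) + A^T *m ys k.+1) <= (mu + c1) * step k.
Proof.
rewrite -[X in enorm X](addrK (mu *: (xs k.+1 - xs k))).
apply: le_trans (enormB _ _) _; rewrite enormZ gtr0_norm// addrC mulrDl.
by rewrite lerD2l.
Qed.

(** [A^T] applied to the dual step is a difference of two stationarity residuals minus a gradient
    difference; [gammaP] inverts [A^T] at the cost of [gamma]. *)
Lemma dual_step k : enorm (ys k.+2 - ys k.+1) <= c3 * step k.+1 + c4 * step k.
Proof.
rewrite -(ler_pM2l gamma0); apply: le_trans (gammaP _) _.
have -> : A^T *m (ys k.+2 - ys k.+1) =
    (grad f (xs k.+2) + A^T *m ys k.+2) - (grad f (xs k.+1) + A^T *m ys k.+1)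
    - (grad f (xs k.+2) - grad f (xs k.+1)).
  by rewrite mulmxBr; apply/matrixP => i j; rewrite !mxE; ring.
apply: le_trans (enormB _ _) _.
have -> : gamma * (c3 * step k.+1 + c4 * step k) =
    (mu + c1) * step k.+1 + (mu + c1) * step k + ell * step k.+1.
  by rewrite /c3 /c4; field; rewrite gt_eqF.
rewrite lerD//; apply: le_trans (enormB _ _) _.
by rewrite lerD// stationarity_residual.
Qed.

Lemma feasibility_residual k :
  A *m xs k.+1 + b - us k.+1 = rho^-1 *: (ys k.+1 - ys k).
Proof.
by rewrite dual_update (addrC (ys k)) addrK scalerA mulVf ?gt_eqF// scale1r.
Qed.

(* The increase of the Lagrangian due to the multiplier update is
   [|dy|^2 / rho], which [dual_step] bounds by the last two primal steps; the
   term of [V] with weight [beta] pays for the older one. *)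
Lemma lyapunov_descent k : W k.+1 <= W k - mu / 4 * step k.+1 ^+ 2.
Proof.
have := primal_descent k.+1; rewrite /W /calV subrr enorm0 expr0n mulr0 addr0.
rewrite -/(step k.+1) -/(step k).
have -> : calL f A b lam rho (xs k.+2) (us k.+2) (ys k.+2) =
    calL f A b lam rho (xs k.+2) (us k.+2) (ys k.+1) +
    enorm (ys k.+2 - ys k.+1) ^+ 2 / rho.
  have [d dE] : exists d, ys k.+2 - ys k.+1 = d by exists (ys k.+2 - ys k.+1).
  rewrite /calL feasibility_residual dE -[in LHS](subrK (ys k.+1) (ys k.+2)) dE.
  by rewrite dotvDl dotvZr -enorm_sqr; ring.
have dy0 := enorm_ge0 (ys k.+2 - ys k.+1).
have dy2 : enorm (ys k.+2 - ys k.+1) ^+ 2 <=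
    2 * c3 ^+ 2 * step k.+1 ^+ 2 + 2 * c4 ^+ 2 * step k ^+ 2.
  apply: le_trans (_ : (c3 * step k.+1 + c4 * step k) ^+ 2 <= _).
    by rewrite ler_pXn2r ?nnegrE ?dual_step// (le_trans dy0 (dual_step _)).
  have := sqr_ge0 (c3 * step k.+1 - c4 * step k); lra.
have {}dy2 : enorm (ys k.+2 - ys k.+1) ^+ 2 / rho <=
    2 * c3 ^+ 2 / rho * step k.+1 ^+ 2 + 2 * c4 ^+ 2 / rho * step k ^+ 2.
  have rV0 : 0 < rho^-1 by rewrite invr_gt0.
  by have := ler_wpM2r (ltW rV0) dy2; lra.
(* This is where the lower bound on [rho] enters: at least [mu / 4] of the primal decrease [mu / 2]
   survives. *)
have small : 2 * c3 ^+ 2 / rho + 2 * c4 ^+ 2 / rho <= mu / 4.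
  rewrite -mulrDl ler_pdivrMr//; move: rho_large; rewrite ltr_pdivrMr//; lra.
have := ler_wpM2r (sqr_ge0 (step k.+1)) small.
rewrite /beta; lra.
Qed.


(** * Passage to the accumulation point *)

Hypotheses (c10 : 0 < c1) (c20 : 0 < c2).
Variables (x0 : 'cV[R]_n) (u0 y0 : 'cV[R]_m).
Hypothesis clustering :
  cluster ((fun k => (xs k, us k, ys k)) @ \oo) (x0, u0, y0).
Let Vstar := calL f A b lam rho x0 u0 y0.
Let near d k := [/\ enorm (xs k - x0) < d, enorm (us k - u0) < d &
                    enorm (ys k - y0) < d].

Lemma c4_gt0 : 0 < c4.
Proof. by rewrite divr_gt0// addr_gt0. Qed.

(** [W] is nonincreasing, and infinitely often the iterates return to where lower semicontinuity
    keeps the Lagrangian above [Vstar - eta]; the proximal term only helps. *)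
Lemma lyapunov_lower_bound j : Vstar <= W j.
Proof.
have mono : {homo W : i j / (i <= j)%N >-> j <= i}.
  apply/nonincreasing_seqP => k; apply: le_trans (lyapunov_descent k) _.
  by rewrite gerBl mulr_ge0 ?sqr_ge0// divr_ge0// ltW.
apply/ler_addgt0Pr => eta eta0.
have [[|k] // jk /= Vk] := cluster_frequently clustering
  (calL_lsc A b rho x0 u0 y0 df lam0 eta0) j.+1.
rewrite -lerBlDr; apply: le_trans Vk _.
apply: le_trans _ (mono j k jk).
rewrite /W /calV lerDl mulr_ge0 ?sqr_ge0// divr_ge0// divr_ge0 ?(ltW rho0)//.
by rewrite mulr_ge0 ?sqr_ge0.
Qed.

Lemma step_vanish eta : 0 < eta -> exists N, forall j, (N <= j)%N -> step j < eta.
Proof.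
have mu4 : 0 < mu / 4 by rewrite divr_gt0.
move=> /(summable_steps_vanish mu4 lyapunov_lower_bound
  (fun j => enorm_ge0 _) lyapunov_descent)[N stepN].
(* The descent inequality controls [step j.+1], hence the shift by one. *)
by exists N.+1 => -[|j] // /stepN.
Qed.

Lemma frequently_near d : 0 < d -> forall N, exists2 j, (N <= j)%N &
  [/\ near d j.+2, step j < d & step j.+1 < d].
Proof.
move=> d0 N; have [M stepM] := step_vanish d0.
have [[|[|j]] // Nj nj] := cluster_frequently clustering
  (nbhs_triple x0 u0 y0 d0) (maxn N M).+2.
move: Nj; rewrite !ltnS geq_max => /andP[Nj Mj].
by exists j => //; split=> //; apply: stepM => //; exact: leqW.
Qed.

Lemma dual_step_le k d : step k <= d -> step k.+1 <= d ->
  enorm (ys k.+2 - ys k.+1) <= (`|c3| + c4) * d.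
Proof.
move=> kd k1d; apply: le_trans (dual_step k) _; rewrite mulrDl.
have s0 : 0 <= step k.+1 by exact: enorm_ge0.
apply: lerD; last by rewrite ler_wpM2l// ltW// c4_gt0.
by apply: le_trans (ler_wpM2r s0 (ler_norm c3)) _; rewrite ler_wpM2l.
Qed.

Lemma feasibility_le k d : step k <= d -> step k.+1 <= d ->
  enorm (A *m xs k.+2 + b - us k.+2) <= (`|c3| + c4) / rho * d.
Proof.
move=> kd k1d; rewrite feasibility_residual enormZ gtr0_norm ?invr_gt0//.
by rewrite mulrAC mulrC ler_wpM2r ?invr_ge0 ?(ltW rho0)// dual_step_le.
Qed.

(** At an index close to the limit with two small preceding steps, every term of the decomposed
    residual is O(d), and [d] is arbitrary. *)
Lemma limit_feasible : A *m x0 + b = u0.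
Proof.
have [C C0 AC] := enorm_mulmx_le A.
have K0 : 0 <= (`|c3| + c4) / rho by rewrite divr_ge0 ?addr_ge0// ltW// c4_gt0.
apply/eqP; rewrite -subr_eq0; apply/eqP.
apply: (@enorm_small_eq0 _ _ _ ((`|c3| + c4) / rho + C + 1)) => [|d d0].
  by rewrite ltr_wpDl// addr_ge0// ltW.
have [j _ [[xd ud _] jd j1d]] := frequently_near d0 0%N.
have -> : A *m x0 + b - u0 = (A *m xs j.+2 + b - us j.+2)
    - A *m (xs j.+2 - x0) + (us j.+2 - u0).
  by rewrite mulmxBr; apply/matrixP => i k; rewrite !mxE; ring.
apply: le_trans (enormD _ _) _; rewrite (mulrDl _ 1) mul1r lerD ?(ltW ud)//.
apply: le_trans (enormB _ _) _; rewrite (mulrDl _ C) lerD//.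
  by rewrite feasibility_le ?ltW.
by apply: le_trans (AC _) _; rewrite ler_wpM2l ?ltW.
Qed.

Lemma limit_stationary : grad f x0 + A^T *m y0 = 0.
Proof.
have [C C0 AC] := enorm_mulmx_le A^T.
apply: (@enorm_small_eq0 _ _ _ (mu + c1 + `|ell| + C)) => [|d d0].
  by rewrite ltr_wpDl// !addr_ge0// ltW.
have [j _ [[xd _ yd] jd j1d]] := frequently_near d0 0%N.
have -> : grad f x0 + A^T *m y0 = (grad f (xs j.+2) + A^T *m ys j.+2)
    - (grad f (xs j.+2) - grad f x0) - A^T *m (ys j.+2 - y0).
  by rewrite mulmxBr; apply/matrixP => i k; rewrite !mxE; ring.
apply: le_trans (enormB _ _) _; rewrite (mulrDl _ C) lerD//; last first.
  by apply: le_trans (AC _) _; rewrite ler_wpM2l ?ltW.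
apply: le_trans (enormB _ _) _; rewrite (mulrDl _ `|ell|) lerD//.
  apply: le_trans (stationarity_residual _) _.
  by rewrite ler_wpM2l ?ltW// addr_gt0.
apply: le_trans (lipf _ _) _; apply: le_trans (_ : `|ell| * enorm (xs j.+2 - x0) <= _).
  by rewrite ler_wpM2r ?enorm_ge0// ler_norm.
by rewrite ler_wpM2l// ltW.
Qed.

(** * Identification of the support and local error bound *)

Hypothesis near_complementary : forall k i,
  `|us k.+1 i 0| <= c2 * step k ^+ 2 \/
  alpha * `|ys k.+1 i 0| <= c2 * step k ^+ 2.

Hypotheses (dgrad : differentiable (grad f) x0) (Afree : row_free A)
  (sosc : SOSC f A x0 u0 y0)
  (eps_vanish : forall eta, 0 < eta ->
    exists N, forall k, (N <= k)%N -> eps k < eta).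
Hypothesis near_proximal : forall k w,
  alpha * lam * h (us k.+1) <= alpha * lam * h w +
    2^-1 * enorm (w - us k.+1) ^+ 2 - alpha * dotv (w - us k.+1) (ys k.+1) + eps k.

Lemma limit_valueE : Vstar = f x0 + lam * h u0.
Proof.
by rewrite /Vstar /calL limit_feasible subrr dotv0r enorm0 expr0n mulr0 !addr0.
Qed.

(** The near-proximal inequality is tested at [w = u0]: close to the limit and for late [k] the
    excess is below [alpha * lam], so [h (us k.+1) < h u0 + 1], and integrality fixes the
    support. *)
Lemma support_stable : exists d N, 0 < d /\ forall k, (N <= k)%N -> near d k.+1 ->
  h (us k.+1) = h u0 /\ forall i, u0 i 0 = 0 -> us k.+1 i 0 <= 0.
Proof.
have [s s0 us0] := coord_gap u0.
have al0 : 0 < alpha * lam by rewrite mulr_gt0.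
have [N epsN] := eps_vanish (divr_gt0 al0 (ltr0Sn R 1)).
(* [M * d] bounds the quadratic and linear terms together, using [d <= 1]; it gets half of
   [alpha * lam] and [eps k] the other half. *)
pose M := 2^-1 + alpha * (enorm y0 + 1).
have M0 : 0 < M.
  by rewrite addr_gt0 ?invr_gt0// mulr_gt0// ltr_wpDl ?enorm_ge0//.
pose d := Num.min (Num.min 1 s) (alpha * lam / (2 * M)).
have d0 : 0 < d by rewrite !lt_min ltr01 s0 divr_gt0// mulr_gt0.
have d1 : d <= 1 by rewrite !ge_min lexx.
have ds : d <= s by rewrite !ge_min lexx orbT.
have dM : M * d <= alpha * lam / 2.
  rewrite -ler_pdivlMl//; apply: le_trans (_ : alpha * lam / (2 * M) <= _).
    by rewrite !ge_min lexx !orbT.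
  by rewrite invfM mulrA mulrC.
exists d, N; split=> // k Nk [_ ud yd].
have pos i : 0 < u0 i 0 -> 0 < us k.+1 i 0.
  move=> ui; have := us0 i (lt0r_neq0 ui); rewrite gtr0_norm// => sle.
  have := le_lt_trans (enorm_coord _ i) ud; rewrite !mxE ltr_norml => /andP[? _].
  lra.
have : h (us k.+1) < h u0 + 1.
  rewrite -(ltr_pM2l al0); apply: le_lt_trans (near_proximal k u0) _.
  rewrite enorm_distC in ud.
  have e0 := enorm_ge0 (u0 - us k.+1).
  have q1 : enorm (u0 - us k.+1) ^+ 2 <= d.
    apply: le_trans (_ : d ^+ 2 <= _); first by rewrite ler_pXn2r ?nnegrE ?(ltW d0) ?(ltW ud).
    by rewrite expr2 ler_piMr// ltW.
  have yb : enorm (ys k.+1) <= enorm y0 + 1.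
    by have := enormD (ys k.+1 - y0) y0; rewrite subrK; lra.
  have q2 : - dotv (u0 - us k.+1) (ys k.+1) <= d * (enorm y0 + 1).
    apply: le_trans (ler_norm _) _; rewrite normrN.
    by apply: le_trans (normr_dotv_le _ _) _; rewrite ler_pM ?enorm_ge0// ltW.
  have := ler_wpM2l (ltW alpha0) q2; have := epsN k Nk; rewrite /M in dM; lra.
move=> /(h_eq_support pos)[hE supp]; split=> // i ui.
by rewrite leNgt; apply/negP => /supp; rewrite ui ltxx.
Qed.

(** Close to the limit, the algorithmic residuals meet the hypotheses of [kkt_error_bound], with [D]
    the sum of the last two primal steps. *)
Lemma local_error_bound : exists d C N, [/\ 0 < d, 0 < C &
  forall j, (N <= j)%N -> near d j.+2 ->
  let D := step j + step j.+1 in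
  [/\ enorm (xs j.+2 - x0) <= C * D, enorm (us j.+2 - u0) <= C * D,
      enorm (ys j.+2 - y0) <= C * D &
      calL f A b lam rho (xs j.+2) (us j.+2) (ys j.+2) - Vstar <= C * D ^+ 2]].
Proof.
(* One constant for all residuals: stationarity, feasibility, and the two alternatives of
   complementarity. *)
pose K := (mu + c1) + (`|c3| + c4) / rho + c2 + c2 / alpha.
have t1 : 0 < mu + c1 by rewrite addr_gt0.
have t2 : 0 < (`|c3| + c4) / rho by rewrite divr_gt0// ltr_wpDl// c4_gt0.
have t4 : 0 < c2 / alpha by rewrite divr_gt0.
have K0 : 0 < K by rewrite !addr_gt0.
have [r [C [r0 C0 bound]]] := kkt_error_bound df dgrad lipf Afree limit_feasible
  limit_stationary sosc (ltW K0).
have [s1 s10 s1P] := coord_gap u0; have [s2 s20 s2P] := coord_gap y0.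
have [d1 [N1 [d10 supp]]] := support_stable.
pose s := Num.min s1 s2; have s0 : 0 < s by rewrite lt_min s10.
pose d := Num.min (Num.min r d1) (Num.min 1 (s / 2)).
have d0 : 0 < d by rewrite !lt_min r0 d10 ltr01 divr_gt0.
have dr : d <= r by rewrite !ge_min lexx.
have dd1 : d <= d1 by rewrite !ge_min lexx orbT.
have d1' : d <= 1 by rewrite !ge_min lexx !orbT.
have ds : d <= s / 2 by rewrite !ge_min lexx !orbT.
(* The first bound ensures [D <= 1]; the second makes near-zero entries smaller than [s / 2]. *)
pose eta := Num.min (2^-1) (s / (2 * K)).
have eta0 : 0 < eta by rewrite lt_min invr_gt0 ltr0Sn divr_gt0// mulr_gt0.
have [N2 stepN] := step_vanish eta0.
exists d, (C + rho / 2 * K ^+ 2), (maxn N1 N2); split=> //.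
  by rewrite ltr_wpDr// mulr_ge0 ?sqr_ge0// divr_ge0// ltW.
move=> j; rewrite geq_max => /andP[N1j N2j] [xd ud yd] D.
have sj := enorm_ge0 (xs j.+1 - xs j); have sj1 := enorm_ge0 (xs j.+2 - xs j.+1).
rewrite -/(step j) in sj; rewrite -/(step j.+1) in sj1.
have jlt : step j < eta by exact: stepN.
have j1lt : step j.+1 < eta by apply: stepN; exact: leqW.
have eta_half : eta <= 2^-1 by rewrite ge_min lexx.
have eta_s : K * eta <= s / 2.
  rewrite -ler_pdivlMl//; apply: le_trans (_ : s / (2 * K) <= _).
    by rewrite ge_min lexx orbT.
  by rewrite invfM mulrA mulrC.
have D0 : 0 <= D by rewrite addr_ge0.
have D1 : D <= 1.
  by rewrite /D; move: (ltW jlt) (ltW j1lt) eta_half; lra.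
have jD : step j <= D by rewrite lerDl.
have j1D : step j.+1 <= D by rewrite lerDr.
have c2K : c2 <= K by rewrite /K; move: t1 t2 t4; lra.
have c2aK : c2 / alpha <= K by rewrite /K; move: t1 t2 c20; lra.
have step2D : step j.+1 ^+ 2 <= D ^+ 2 by rewrite ler_pXn2r.
have step2e : step j.+1 ^+ 2 < eta.
  by rewrite expr2; apply: le_lt_trans j1lt; rewrite ler_piMr// (le_trans j1D).
have small c t : 0 < c -> c <= K -> t <= c * step j.+1 ^+ 2 ->
    t <= K * D ^+ 2 /\ t < s / 2.
  move=> c0 cK tc; split.
    by apply: le_trans tc _; rewrite ler_pM ?sqr_ge0 ?(ltW c0).
  apply: lt_le_trans eta_s; apply: le_lt_trans tc _.
  apply: le_lt_trans (_ : K * step j.+1 ^+ 2 < _).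
    by rewrite ler_wpM2r ?sqr_ge0.
  by rewrite ltr_pM2l.
have feasD : enorm (A *m xs j.+2 + b - us j.+2) <= K * D.
  apply: le_trans (feasibility_le jD j1D) _; rewrite ler_wpM2r//.
  by rewrite /K; move: t1 t4 c20; lra.
have statD : enorm (grad f (xs j.+2) + A^T *m ys j.+2) <= K * D.
  apply: le_trans (stationarity_residual _) _; rewrite ler_pM ?(ltW t1)//.
  by rewrite /K; move: t2 t4 c20; lra.
have [] := supp _ (leqW N1j); first by split; apply: lt_le_trans dd1.
move=> hE usgn.
have udi i := le_lt_trans (enorm_coord (us j.+2 - u0) i) ud.
have ydi i := le_lt_trans (enorm_coord (ys j.+2 - y0) i) yd.
have [|||||||xC uC yC vC] := bound (xs j.+2) (us j.+2) (ys j.+2) D => //.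
- exact: lt_le_trans dr.
- by rewrite D0.
- move=> i; have := udi i; have := ydi i; rewrite !mxE => /ltW yi /ltW ui.
  by split; [exact: le_trans ui d1'|exact: le_trans yi d1'].
- move=> i; have := udi i; have := ydi i; rewrite !mxE => yi ui.
  (* An entry below [s / 2] and within [s / 2] of its limit forces that limit below the gap [s],
     hence to be zero. *)
  have [/(small _ _ c20 c2K)[uD us2]|ya] := near_complementary j.+1 i.
    left; split=> //; apply: contraTeq us2 => /s1P s1u.
    have ss1 : s <= s1 by rewrite ge_min lexx.
    have : `|u0 i 0| <= `|us j.+2 i 0| + `|us j.+2 i 0 - u0 i 0|.
      by rewrite -[X in `|X| <= _](subKr (us j.+2 i 0)) ler_normB.
    by rewrite -leNgt; move: ds ui ss1 s1u; lra.
  have : `|ys j.+2 i 0| <= c2 / alpha * step j.+1 ^+ 2.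
    by rewrite mulrAC ler_pdivlMr// mulrC.
  move=> /(small _ _ t4 c2aK)[yD ys2].
  right; split=> //; apply: contraTeq ys2 => /s2P s2y.
  have ss2 : s <= s2 by rewrite ge_min lexx orbT.
  have : `|y0 i 0| <= `|ys j.+2 i 0| + `|ys j.+2 i 0 - y0 i 0|.
    by rewrite -[X in `|X| <= _](subKr (ys j.+2 i 0)) ler_normB.
  by rewrite -leNgt; move: ds yi ss2 s2y; lra.
have rK : 0 <= rho / 2 * K ^+ 2 by rewrite mulr_ge0 ?sqr_ge0// divr_ge0// ltW.
have weaken t : t <= C * D -> t <= (C + rho / 2 * K ^+ 2) * D.
  by move=> tC; apply: le_trans tC _; rewrite ler_wpM2r// lerDl.
split; [exact: weaken..|].
(* The [h] terms cancel by [hE]; the penalty term accounts for the extra [rho / 2 * K ^+ 2]. *)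
rewrite limit_valueE /calL hE.
have := ler_pXn2r (isT : (0 < 2)%N) (enorm_ge0 (A *m xs j.+2 + b - us j.+2)).
move=> /(_ _ (mulr_ge0 (ltW K0) D0)); rewrite feasD => /idP sq.
have := ler_wpM2l (ltW rho0) sq; move: vC; lra.
Qed.

(** Trapping argument: inside the ball the error bound puts the iterate within [2 * C * e] of the
    limit, and the next move is at most [M * e], so the next iterate is again inside. Induction
    starts at one good index. *)
Lemma eventually_quadratic_bound : exists C J, 0 < C /\ forall j, (J <= j)%N ->
  calL f A b lam rho (xs j.+2) (us j.+2) (ys j.+2) - Vstar
    <= C * (step j + step j.+1) ^+ 2.
Proof.
have [d [C [N [d0 C0 bound]]]] := local_error_bound.
have [Ca Ca0 AC] := enorm_mulmx_le A.
have s1 : 0 < `|c3| + c4 by rewrite ltr_wpDl// c4_gt0.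
have s2 : 0 < (`|c3| + c4) / rho by rewrite divr_gt0.
(* [M] dominates the factors for one move of [x], [y] and [u], the last through the constraint
   residuals. *)
pose M := 1 + (`|c3| + c4) + Ca + 2 * ((`|c3| + c4) / rho).
have M0 : 0 < 2 * C + M by rewrite /M; move: s1 s2 C0 Ca0; lra.
pose e := d / (2 * (2 * C + M)).
have e0 : 0 < e by rewrite divr_gt0// mulr_gt0.
have eE : 2 * C * e + M * e < d.
  rewrite -mulrDl (_ : _ * e = d / 2); first by rewrite ltr_pdivrMr// ltr_pMr// ltr1n.
  by rewrite /e; field; rewrite gt_eqF.
have [N1 stepN] := step_vanish e0.
have [J NJ [nearJ _ _]] := frequently_near d0 (maxn N N1).
exists C, J; split=> // j Jj.
suff near_d : near d j.+2.
  have [] // := bound j _ near_d; apply: leq_trans Jj.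
  by apply: leq_trans NJ; rewrite leq_maxl.
rewrite -(subnKC Jj); elim: (j - J)%N => [|i IH]; first by rewrite addn0.
rewrite addnS; set k := (J + i)%N in IH *.
have Nk : (N <= k)%N by apply: leq_trans (leq_addr _ _); apply: leq_trans NJ; rewrite leq_maxl.
have N1k : (N1 <= k)%N by apply: leq_trans (leq_addr _ _); apply: leq_trans NJ; rewrite leq_maxr.
have st i' : (k <= i')%N -> step i' <= e by move=> ki; apply/ltW/stepN/(leq_trans N1k ki).
have st0 := st _ (leqnn k); have st1 := st _ (leqnSn k).
have st2 := st _ (leqW (leqnSn k)).
have [xC uC yC _] := bound k Nk IH.
have De : C * (step k + step k.+1) <= 2 * C * e.
  by rewrite (mulrC 2) -mulrA ler_wpM2l ?(ltW C0)// mulr_natl mulr2n lerD.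
have tri p (v w z : 'cV[R]_p) : enorm (v - z) <= enorm (v - w) + enorm (w - z).
  by rewrite -(subrKA w) enormD.
have close p (v w z : 'cV[R]_p) : enorm (w - z) <= C * (step k + step k.+1) ->
    enorm (v - w) <= M * e -> enorm (v - z) < d.
  move=> wz vw; apply: le_lt_trans (tri _ _ w _) _.
  by move: wz vw De eE; lra.
have Me c : c <= M -> c * e <= M * e by move=> cM; rewrite ler_wpM2r// ltW.
split; [apply: close xC _|apply: close uC _|apply: close yC _].
- apply: le_trans st2 _; rewrite -[leLHS]mul1r Me//.
  by rewrite /M; move: s1 s2 Ca0; lra.
- have -> : us k.+3 - us k.+2 = A *m (xs k.+3 - xs k.+2)
      - ((A *m xs k.+3 + b - us k.+3) - (A *m xs k.+2 + b - us k.+2)).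
    by rewrite mulmxBr; apply/matrixP => p q; rewrite !mxE; ring.
  apply: le_trans (enormB _ _) _.
  have q1 : enorm (A *m (xs k.+3 - xs k.+2)) <= Ca * e.
    by apply: le_trans (AC _) _; rewrite ler_wpM2l// ltW.
  have q2 := enormB (A *m xs k.+3 + b - us k.+3) (A *m xs k.+2 + b - us k.+2).
  have q3 := feasibility_le st0 st1; have q4 := feasibility_le st1 st2.
  apply: le_trans (_ : (Ca + 2 * ((`|c3| + c4) / rho)) * e <= _).
    by move: q1 q2 q3 q4; lra.
  by rewrite Me// /M; move: s1; lra.
- apply: le_trans (dual_step_le st1 st2) _; rewrite Me//.
  by rewrite /M; move: s2 Ca0; lra.
Qed.

Lemma lyapunov_linear_rate : exists c q J, [/\ 0 < c, 0 < q < 1 &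
  forall j, (J <= j)%N -> W j - Vstar <= c * q ^+ j].
Proof.
have [C [J [C0 bound]]] := eventually_quadratic_bound.
have beta0 : 0 <= beta by rewrite divr_ge0 ?(ltW rho0)// mulr_ge0 ?sqr_ge0.
(* [2 * C] comes from the square of a sum of two steps, [beta / 2] from the proximal term of [W]. *)
pose C2 := 2 * C + beta / 2.
have C20 : 0 < C2.
  by apply: ltr_wpDr; [exact: divr_ge0 beta0 (ler0n _ 2)|exact: mulr_gt0].
have w0 j : 0 <= W j - Vstar by rewrite subr_ge0 lyapunov_lower_bound.
have [|j Jj|c [q [c0 q01 rate]]] :=
    @two_step_linear_rate _ (fun j => W j - Vstar) (C2 * (4 / mu)) J _ w0.
- by rewrite mulr_gt0// divr_gt0.
- have quad : W j.+2 - Vstar <= C2 * (step j.+1 ^+ 2 + step j.+2 ^+ 2).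
    have := bound j.+1 (leqW Jj); rewrite {1}/W /calV -/(step j.+2) /C2.
    have p1 := mulr_ge0 beta0 (sqr_ge0 (step j.+1)).
    have p2 := mulr_ge0 (ltW C0) (sqr_ge0 (step j.+1 - step j.+2)).
    by move: p1 p2; lra.
  (* Two consecutive descents add up to exactly the two squared steps on the right. *)
  apply: le_trans quad _; rewrite -mulrA ler_wpM2l ?(ltW C20)//.
  rewrite mulrAC ler_pdivlMr//.
  have := lyapunov_descent j; have := lyapunov_descent j.+1; lra.
- by exists c, q, J.
Qed.

End Iterates.

(** * Assembly: from the algorithm to the linear rate *)

Theorem theorem16 (R : realType) (n m : nat)
    (f : 'cV[R]_n -> R) (A : 'M[R]_(m, n)) (b : 'cV[R]_m)
    (lam mu rho sigma_f ell_f L_f ell_g alpha t c1 c2 gamma : R)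
    (eps : nat -> R)
    (xs : nat -> 'cV[R]_n) (us ys : nat -> 'cV[R]_m)
    (xstar : 'cV[R]_n) (ustar ystar : 'cV[R]_m)
    (lam_gt0 : 0 < lam) (mu_gt0 : 0 < mu)
    (f_C2 : C2 f)
    (f_wconvex : weakly_convex sigma_f f)
    (f_grad_lip : lipschitz_vec ell_f (grad f))
    (f_hess_lip : lipschitz_op L_f (hess f))
    (A_full_row_rank : row_free A)
    (gamma_gt0 : 0 < gamma)
    (gammaE : is_lambda_min (A *m A^T) (gamma ^+ 2))
    (f_coercive : coercive f)
    (mu_gt_sigma : sigma_f < mu)
    (c1_gt0 : 0 < c1) (c2_gt0 : 0 < c2)
    (eps_gt0 : forall k, 0 < eps k) (eps_cvg0 : eps @ \oo --> (0 : R))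
    (ell_g_gt0 : 0 < ell_g)
    (gk_lip : forall k, lipschitz_vec ell_g (grad (gk f A b mu rho (ys k) (xs k))))
    (alpha_itv : 0 < alpha < 1 / ell_g)
    (t_itv : 0 < t < 2 / ell_g) :
  let c3 := (mu + ell_f + c1) / gamma in
  let c4 := (mu + c1) / gamma in
  let beta := 4 * c4 ^+ 2 / rho in
  Num.max (8 * (c3 ^+ 2 + c4 ^+ 2) / mu) (4 * ell_f / gamma ^+ 2) < rho ->
  inalm_seq f A b lam mu rho sigma_f alpha t c1 c2 eps xs us ys ->
  cluster ((fun k => (xs k, us k, ys k)) @ \oo) (xstar, ustar, ystar) ->
  SOSC f A xstar ustar ystar ->
  let V k := calV f A b lam rho beta (xs k) (us k) (ys k) (xs k.-1) in
  let Vstar := calV f A b lam rho beta xstar ustar ystar xstar in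
  Vstar = f xstar + lam * h ustar /\
  exists (knu : nat) (cnu q : R),
    [/\ (0 < knu)%N, 0 < cnu, 0 < q < 1 &
        forall k, (knu <= k)%N -> V k - Vstar <= cnu * q ^+ k].
Proof.
move=> c3 c4 beta; rewrite gt_max => /andP[rho_large _] iter clus sosc V Vstar.
have [df dgrad _] := f_C2.
have alpha0 : 0 < alpha by case/andP: alpha_itv.
have rho0 : 0 < rho.
  apply: le_lt_trans rho_large; rewrite divr_ge0 ?(ltW mu_gt0)// mulr_ge0//.
  by rewrite addr_ge0 ?sqr_ge0.
have gammaP y : gamma * enorm y <= enorm (A^T *m y).
  rewrite -(ler_pXn2r (_ : 0 < 2)%N) ?nnegrE ?enorm_ge0//; last first.
    by rewrite mulr_ge0 ?enorm_ge0// ltW.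
  (* The square of [enorm (A^T *m y)] is the quadratic form of [A *m A^T], bounded below by its
     smallest eigenvalue. *)
  rewrite exprMn [leRHS]enorm_sqr dotv_adjoint trmxK mulmxA.
  by apply: rayleigh_lambda_min gammaE; rewrite trmx_mul trmxK.
have dual_update k : ys k.+1 = ys k + rho *: (A *m xs k.+1 + b - us k.+1).
  by have [] := iter k.
have primal_descent k : calV f A b lam rho mu (xs k.+1) (us k.+1) (ys k) (xs k)
    <= calV f A b lam rho mu (xs k) (us k) (ys k) (xs k) by have [] := iter k.
have tests k : inexact (gk f A b mu rho (ys k) (xs k)) lam alpha c1 c2 (eps k)
    (xs k) (col_mx (xs k.+1) (us k.+1)).
  have [[zeta _ [[_ _ ok]|[_ [j [ok _ ->]]]]] _ _] := iter k; exact: ok.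
have residuals k := inexact_residuals df lam_gt0 alpha0 (dual_update k) (tests k).
have residual k : enorm (grad f (xs k.+1) + A^T *m ys k.+1 +
    mu *: (xs k.+1 - xs k)) <= c1 * enorm (xs k.+1 - xs k).
  by have [] := residuals k.
have eps_vanish eta : 0 < eta -> exists N, forall k, (N <= k)%N -> eps k < eta.
  move=> eta0; have /cvgr_lt/(_ eta eta0)[N _ NP] := eps_cvg0.
  by exists N => k Nk; exact: NP.
have VstarE : Vstar = f xstar + lam * h ustar.
  rewrite /Vstar /calV subrr enorm0 expr0n mulr0 addr0.
  exact: (limit_valueE df f_grad_lip lam_gt0 mu_gt0 rho0 gamma_gt0 gammaP
    rho_large dual_update residual primal_descent c1_gt0 clus).
split=> //.
have [k i|k w|c [q [J [c0 q01 rate]]]] :=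
    lyapunov_linear_rate df f_grad_lip lam_gt0 mu_gt0 rho0 alpha0 gamma_gt0
    gammaP rho_large dual_update residual primal_descent c1_gt0 c2_gt0 clus
    _ (dgrad _) A_full_row_rank sosc eps_vanish _.
- by have [_ + _] := residuals k; apply.
- by have [_ _ +] := residuals k; apply.
have q0 : 0 < q by case/andP: q01.
(* Undoing the shift [V k.+1 = W k] costs a factor [q^-1]; a positive [knu] also keeps [k.-1] a true
   predecessor. *)
exists J.+1, (c / q), q; split=> //; first exact: divr_gt0.
move=> [|k] // Jk; rewrite exprS mulrA divfK ?gt_eqF//.
have -> : Vstar = calL f A b lam rho xstar ustar ystar.
  by rewrite /Vstar /calV subrr enorm0 expr0n mulr0 addr0.
exact: rate.
Qed.
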